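(* Let $\alpha\ge 0$ and $-1<x<1$. Write $U_n=R_n^{(\alpha,\alpha)}$ for integers $n\ge 0$. If $k$ is the least index for which $U_k(x)=\min_{n\ge 0}U_n(x)$, then \[ U_0(x)\ge U_1(x)\ge\cdots\ge U_k(x). \]
   Context: For real $a,b>-1$ and integers $n\ge 0$, $R_n^{(a,b)}(x)=P_n^{(a,b)}(x)/P_n^{(a,b)}(1)$, where $P_n^{(a,b)}$ is the Jacobi polynomial of degree $n$ (orthogonal on $[-1,1]$ with respect to the weight $(1-x)^a(1+x)^b$). *)

(* Defs.v *)
From HB Require Import structures.
From mathcomp Require Import all_boot all_order all_algebra.
From mathcomp Require Import all_classical all_reals all_analysis.

Set Implicit Arguments.
Unset Strict Implicit.
Unset Printing Implicit Defensive.

Import Order.TTheory GRing.Theory Num.Theory.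
Import numFieldNormedType.Exports.

Local Open Scope classical_set_scope.
Local Open Scope ring_scope.

(* At t = 1 (resp. t = -1), [powR] gives 0 `^ a = (a == 0)%:R; for negative
   exponents this junk value only concerns an endpoint, a null set for the
   integrals below. *)
Definition jacobi_weight (R : realType) (a b t : R) : R :=
  (1 - t) `^ a * (1 + t) `^ b.

Definition jacobi_dot (R : realType) (a b : R) (p q : {poly R}) : R :=
  \int[@lebesgue_measure R]_(t in `[-1, 1])
    (p.[t] * q.[t] * jacobi_weight a b t).

(* [is_jacobi a b P]: P n is the Jacobi polynomial P_n^{(a,b)} for every n.
   As in Szego, the family is determined by degree, orthogonality and the
   normalization P_n^{(a,b)}(1) = (a + 1) ... (a + n) / n!; the latter plays no
   role in the quotients R_n^{(a,b)}.  Meaningful for a, b > -1, where all the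
   integrals converge. *)
Definition is_jacobi (R : realType) (a b : R) (P : nat -> {poly R}) : Prop :=
  [/\ forall n, size (P n) = n.+1,
      forall m n, m <> n -> jacobi_dot a b (P m) (P n) = 0
    & forall n, (P n).[1] = \prod_(i < n) ((a + i.+1%:R) / i.+1%:R)].

(* R_n^{(a,b)}(x), when P is the Jacobi family with parameters a, b. *)
Definition normalized_at (R : realType) (P : nat -> {poly R}) (n : nat)
    (x : R) : R :=
  (P n).[x] / (P n).[1].

Definition attains_min (R : realType) (u : nat -> R) (k : nat) : Prop :=
  forall n, u k <= u n.

Definition least_argmin (R : realType) (u : nat -> R) (k : nat) : Prop :=
  attains_min u k /\ forall j, attains_min u j -> (k <= j)%N.

(* Main.v *)
Require Import Defs.
From HB Require Import structures.
From mathcomp Require Import all_boot all_order all_algebra.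
From mathcomp Require Import all_classical all_reals all_analysis.
From mathcomp Require Import ring lra.

Set Implicit Arguments.
Unset Strict Implicit.
Unset Printing Implicit Defensive.

Import Order.TTheory GRing.Theory Num.Theory.
Import numFieldNormedType.Exports.

Local Open Scope ring_scope.

(** Write x = cos t and r = 2 alpha + 1 >= 1.  The values u n = U_n(x)
satisfy a three-term recurrence which reads
    u (n+1) - x u n = n / (n + r) * (x u n - u (n-1)) :
the plane is rotated by the angle t, and one coordinate is then shrunk by the
factor n / (n + r).  The quadratic form
    E n = u n ^ 2 + u (n+1) ^ 2 - 2 x u n u (n+1),
preserved by the rotation, therefore decreases, and sin^2 t * u m ^ 2 <= E n
for all m >= n.

Let j be the end of the first descent, u 0 >= ... >= u j < u (j+1).  It is
enough to see that u j is the global minimum: if the sequence went up before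
reaching the least minimiser k, then j would be a smaller minimiser.  Now u j is
negative, and every later value is >= u j as soon as E N <= sin^2 t * u j ^ 2
for some N, the values up to N being checked directly ([energy_trap]).  At j
itself this may fail: the integers sample an oscillation of angular step t, so
the first discrete minimum can miss the bottom of the wave, but E j exceeds
sin^2 t * u j ^ 2 by at most (1 - x)^2 u j ^ 2.  The proof shows that
the damping removes this excess before u can get below u j again.

The damping at index n has strength about 2 r / n, so j has to be bounded in
terms of 1 - x.  The differences of u are multiples of Jacobi polynomials with
parameters (alpha + 1, alpha), and a Sturm comparison of their
recurrence with an explicit square gives
    (1 - x) (4 (j - 1)(j + r) + (r + 2)(r + 3)) <= (r + 5)^2
([decreasing_run_bound]).  Three regimes remain.
 - For 3 <= j <= 12 r two damped steps are enough ([first_min_moderate]).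
 - For j > 12 r the step t is small; one waits until u has climbed to half its
   depth, where one damped step costs more energy than the excess
   ([first_min_large]).
 - For j = 1, 2 explicit formulas up to u 6 are compared ([first_min_one],
   [first_min_two]).  No estimate with slack can work there: for alpha = 0 and
   x = -1/3 one has u 1 = u 2 = u 5 = -1/3.

The recurrence comes from orthogonality in the classical way.  The operator
(1 - X^2) p'' - (r + 1) X p' is symmetric for the scalar product with weight
(1 - t^2)^alpha and preserves the degree filtration, so the orthogonal
polynomials are its eigenvectors; its eigenvalues are distinct, so they are
proportional to the polynomials defined by the recurrence, which are
eigenvectors too ([jacobi_gegenbauer]). *)

(** * A damped rotation and its energy *)

(** The recurrence of the ultraspherical polynomials normalised at 1, arranged so
that a rotation by arccos x and a damping by (n+1) / (n+1+r) become visible. *)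
Definition gegenbauer_seq (R : realFieldType) (r x : R) (u : nat -> R) : Prop :=
  [/\ u 0%N = 1, u 1%N = x &
      forall n, (n.+1%:R + r) * (u n.+2 - x * u n.+1)
                = n.+1%:R * (x * u n.+1 - u n)].

(** Equal to (1 - x^2) (u n)^2 + (u (n+1) - x u n)^2 and also to
(1 - x^2) (u (n+1))^2 + (x u (n+1) - u n)^2; the recurrence shrinks the second
square of the latter into that of the former, one index later. *)
Definition energy (R : realFieldType) (x : R) (u : nat -> R) (n : nat) : R :=
  u n ^+ 2 + u n.+1 ^+ 2 - 2 * x * u n * u n.+1.

Lemma sqr_sin_gt0 (R : realFieldType) (x : R) : -1 < x < 1 -> 0 < 1 - x ^+ 2.
Proof. by move=> /andP[x1 x2]; nra. Qed.

Lemma energy_step (R : realFieldType) (r x : R) (u : nat -> R) n :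
  gegenbauer_seq r x u ->
  (n.+1%:R + r) ^+ 2 * (energy x u n - energy x u n.+1)
  = r * (2 * n.+1%:R + r) * (x * u n.+1 - u n) ^+ 2.
Proof.
case=> _ _ /(_ n) h; rewrite /energy.
transitivity ((n.+1%:R + r) ^+ 2 * (x * u n.+1 - u n) ^+ 2
   - ((n.+1%:R + r) * (u n.+2 - x * u n.+1)) ^+ 2); first by ring.
rewrite h; ring.
Qed.

Lemma energy_le (R : realFieldType) (r x : R) (u : nat -> R) n m :
  1 <= r -> gegenbauer_seq r x u -> (n <= m)%N -> energy x u m <= energy x u n.
Proof.
move=> r1 hu; elim: m => [|m IH]; first by rewrite leqn0 => /eqP ->.
rewrite leq_eqVlt ltnS => /orP[/eqP -> //|/IH]; apply: le_trans.
have m0 := ler0n R m.+1.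
rewrite -subr_ge0 -(pmulr_rge0 _ (_ : 0 < (m.+1%:R + r) ^+ 2)).
  by rewrite (energy_step _ hu) mulr_ge0 ?sqr_ge0 // mulr_ge0 //; lra.
by rewrite exprn_gt0 //; lra.
Qed.

Lemma energy_ge_left (R : realFieldType) (x : R) (u : nat -> R) n :
  (1 - x ^+ 2) * u n ^+ 2 <= energy x u n.
Proof. by rewrite /energy; have := sqr_ge0 (u n.+1 - x * u n); nra. Qed.

(** The way in which a local minimum is recognised as global: a sequence
whose energy has dropped to the level that u j alone would account for can no
longer reach below u j. *)
Lemma energy_trap (R : realFieldType) (r x : R) (u : nat -> R) (j N : nat) :
  1 <= r -> -1 < x < 1 -> gegenbauer_seq r x u -> u j < 0 ->
  (forall n, (n < j)%N -> u n.+1 <= u n) ->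
  (forall n, (j < n < N)%N -> u j <= u n) ->
  energy x u N <= (1 - x ^+ 2) * u j ^+ 2 -> forall n, u j <= u n.
Proof.
move=> r1 /sqr_sin_gt0 s hu uj mono mid EN n.
have dec m : (m <= j)%N -> u j <= u m.
  elim: j {uj mid EN} mono => [|j IH] mono; first by rewrite leqn0 => /eqP ->.
  rewrite leq_eqVlt ltnS => /orP[/eqP -> //|mj].
  apply: le_trans (mono _ (ltnSn j)) (IH _ mj) => k kj.
  by apply: mono; apply: ltnW.
have [/dec //|jn] := leqP n j.
have [nN|Nn] := ltnP n N; first by apply: mid; rewrite jn.
have : (1 - x ^+ 2) * u n ^+ 2 <= (1 - x ^+ 2) * u j ^+ 2.
  apply: le_trans (energy_ge_left _ _ _) _.
  exact: le_trans (energy_le r1 hu Nn) EN.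
by rewrite ler_pM2l // => h; rewrite leNgt; apply/negP => lt; nra.
Qed.

Lemma gegenbauer_next (R : realFieldType) (r x : R) (u : nat -> R) n :
  1 <= r -> gegenbauer_seq r x u ->
  u n.+2 = x * u n.+1 + n.+1%:R / (n.+1%:R + r) * (x * u n.+1 - u n).
Proof.
move=> r1 [_ _ /(_ n) h]; have n0 := ltr0Sn R n.
have k0 : n.+1%:R + r != 0 by rewrite gt_eqF //; lra.
apply: (@mulfI _ (n.+1%:R + r)) => //.
rewrite mulrDr [X in _ = _ + X]mulrA [_ * (_ / _)]mulrC divfK // -h; ring.
Qed.

(** * The first descent cannot be too long *)

(** Up to a positive factor independent of n, the Jacobi polynomial with
parameters (alpha + 1, alpha), normalised at 1; for r = 2 alpha + 1. *)
Definition slope (R : realFieldType) (r : R) (u : nat -> R) (n : nat) : R :=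
  (u n - u n.+1) / (2 * n%:R + r + 1).

Lemma slope_recurrence (R : realFieldType) (r x : R) (u : nat -> R) n :
  1 <= r -> gegenbauer_seq r x u ->
  (n%:R + 1 + r) * (2 * n%:R + r + 3) / (2 * n%:R + r + 2)
    * (slope r u n.+1 - slope r u n)
  = n%:R * (2 * n%:R + r - 1) / (2 * n%:R + r)
    * (slope r u n - slope r u n.-1)
    - (1 - x) * (2 * n%:R + r + 1) * slope r u n.
Proof.
move=> r1 [u0 u1 rec]; rewrite /slope.
have divide (k y z t : R) : 0 < k -> k * (y - z) = t -> y = z + t / k.
  by move=> k0 <-; rewrite mulrC mulKf ?gt_eqF // addrC subrK.
case: n => [|n] /=.
  have := rec 0%N; rewrite u0 u1 => h.
  have -> : u 2%N = x * x + (x * x - 1) / (1 + r).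
    by apply: divide; [lra | rewrite h; ring].
  by field; rewrite !gt_eqF //=; lra.
have n0 := ler0n R n.
have h1 := rec n; have h2 := rec n.+1.
have e2 : u n.+2 = x * u n.+1 + n.+1%:R * (x * u n.+1 - u n) / (n.+1%:R + r).
  by apply: divide h1; rewrite -natr1; lra.
have e3 : u n.+3 = x * u n.+2 + n.+2%:R * (x * u n.+2 - u n.+1) / (n.+2%:R + r).
  by apply: divide h2; rewrite -!natr1; lra.
rewrite e3 e2 -!natr1; field.
by rewrite !gt_eqF //=; lra.
Qed.

(** A Sturm comparison.  The test sequence q n = (v M - v n)^2, with
v n = n (n + r + 1) and M = m + 1, satisfies the recurrence of the slopes p n with
L n in place of -(1 - x) p n, and (1 - x) q n + L n is a quadratic polynomial in
v M - v n which is positive when the bound fails.  Then the discrete Wronskian X of the slopes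
with q stays negative up to the index where q vanishes, which forces a negative
slope.  The double zero of q is what keeps the comparison valid up to the end. *)
Lemma decreasing_run_bound (R : realFieldType) (r x : R) (u : nat -> R) (m : nat) :
  1 <= r -> x < 1 -> gegenbauer_seq r x u ->
  (forall n, (n <= m.+1)%N -> u n.+1 <= u n) ->
  (1 - x) * (4 * (m%:R + 1) * (m%:R + 2 + r) + (r + 2) * (r + 3))
  <= (r + 5) ^+ 2.
Proof.
move=> r1 x1 hu mono; rewrite leNgt; apply/negP => big.
pose v (n : nat) : R := n%:R * (n%:R + r + 1).
pose q n := (v m.+1 - v n) ^+ 2.
pose A (n : nat) : R := (n%:R + 1 + r) * (2 * n%:R + r + 3) / (2 * n%:R + r + 2).
pose C (n : nat) : R := n%:R * (2 * n%:R + r - 1) / (2 * n%:R + r).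
pose c (n : nat) : R := 2 * n%:R + r + 1.
pose L n := 4 * v n + (r + 2) * (r + 3) - 2 * (r + 3) * (v m.+1 - v n).
pose X n := slope r u n.+1 * q n - slope r u n * q n.+1.
have A0 n : 0 < A n by have := ler0n R n => n0; rewrite divr_gt0 ?mulr_gt0 //; lra.
have C0 n : 0 <= C n by have := ler0n R n => n0; rewrite divr_ge0 ?mulr_ge0 //; lra.
have c0 n : 0 < c n by have := ler0n R n => n0; rewrite /c; lra.
have q_rec n : A n * (q n.+1 - q n) = C n * (q n - q n.-1) + c n * L n.
  rewrite /A /C /c /L /q; set M := v m.+1; rewrite /v.
  case: n => [|n] /=; first by field; rewrite !gt_eqF //=; lra.
  have n0 := ler0n R n.
  by rewrite -!natr1; field; rewrite !gt_eqF //=; lra.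
have p_rec n : A n * (slope r u n.+1 - slope r u n)
    = C n * (slope r u n - slope r u n.-1) - (1 - x) * c n * slope r u n.
  exact: slope_recurrence.
(* Complete the square after multiplying by 1 - x. *)
have gap n : 0 < (1 - x) * q n + L n.
  have e0 : 0 < 1 - x by lra.
  rewrite -(pmulr_rgt0 _ e0) /q /L.
  have -> : (1 - x) * ((1 - x) * (v m.+1 - v n) ^+ 2 +
     (4 * v n + (r + 2) * (r + 3) - 2 * (r + 3) * (v m.+1 - v n)))
   = ((1 - x) * (v m.+1 - v n) - (r + 5)) ^+ 2
     + ((1 - x) * (4 * v m.+1 + (r + 2) * (r + 3)) - (r + 5) ^+ 2) by ring.
  rewrite ltr_wpDl ?sqr_ge0 // subr_gt0; move: big.
  by congr (_ < _); rewrite /v -natr1; ring.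
have p_ge0 n : (n <= m.+1)%N -> 0 <= slope r u n.
  by move=> nm; rewrite /slope divr_ge0 ?subr_ge0 ?mono //; exact: ltW (c0 n).
have p0_gt0 : 0 < slope r u 0.
  case: hu => u0 u1 _; rewrite /slope u0 u1 divr_gt0 //; lra.
have X_rec n : A n * X n = C n * (slope r u n * q n.-1 - slope r u n.-1 * q n)
    - c n * slope r u n * ((1 - x) * q n + L n).
  have -> : A n * X n = A n * (slope r u n.+1 - slope r u n) * q n
      - slope r u n * (A n * (q n.+1 - q n)) by rewrite /X; ring.
  by rewrite p_rec q_rec; ring.
have X_lt0 n : (n <= m)%N -> X n < 0.
  elim: n => [_|n IH nm].
    rewrite -(pmulr_rlt0 _ (A0 0%N)) X_rec /C !mul0r sub0r oppr_lt0.
    by apply: mulr_gt0 (gap 0%N); exact: mulr_gt0.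
  rewrite -(pmulr_rlt0 _ (A0 n.+1)) X_rec /=.
  rewrite -[slope r u n.+1 * q n - _]/(X n).
  (* C 0 = 0 starts the induction, the later C n are positive. *)
  have Cp : 0 < C n.+1.
    by have := ler0n R n.+1; have := ltr0Sn R n => n0 n1; rewrite divr_gt0 ?mulr_gt0 //; lra.
  have h1 : C n.+1 * X n < 0 by rewrite pmulr_rlt0 // IH // ltnW.
  have h2 : 0 <= c n.+1 * slope r u n.+1 * ((1 - x) * q n.+1 + L n.+1).
    apply: mulr_ge0 (ltW (gap n.+1)); apply: mulr_ge0 (ltW (c0 n.+1)) _.
    by apply: p_ge0; apply: leqW.
  lra.
have := X_lt0 m (leqnn m); rewrite /X /q subrr expr0n /= mulr0 subr0.
by rewrite ltNge mulr_ge0 ?sqr_ge0 ?p_ge0.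
Qed.

(** * Paying for the sampling error within two steps *)

(** A nonnegative combination of squares of affine functions is convex. *)
Lemma convex_le_of_endpoints (R : realFieldType) (A B A' B' s k d D c : R) :
  0 <= s -> 0 <= k -> 0 <= d <= D ->
  s * A ^+ 2 + k * A' ^+ 2 <= c ->
  s * (A + B * D) ^+ 2 + k * (A' + B' * D) ^+ 2 <= c ->
  s * (A + B * d) ^+ 2 + k * (A' + B' * d) ^+ 2 <= c.
Proof.
move=> s0 k0 /andP[d0 dD] h0 h1.
have [D0|D0] := eqVneq D 0.
  have -> : d = 0 by lra.
  by rewrite !mulr0 !addr0.
have Dp : 0 < D by rewrite lt_def D0; lra.
pose l := d / D.
have dE : d = l * D by rewrite /l divfK.
have l0 : 0 <= l by rewrite /l divr_ge0 // ltW.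
have l1 : 0 <= 1 - l by rewrite subr_ge0 /l ler_pdivrMr // mul1r.
have := mulr_ge0 l0 (_ : 0 <= c - (s * (A + B * D) ^+ 2 + k * (A' + B' * D) ^+ 2)).
have := mulr_ge0 l1 (_ : 0 <= c - (s * A ^+ 2 + k * A' ^+ 2)).
rewrite !subr_ge0 => /(_ h0) h0' /(_ h1) h1'.
have e0 : 0 <= l * (1 - l) * (s * (B * D) ^+ 2 + k * (B' * D) ^+ 2).
  have sq (y z : R) : 0 <= y -> 0 <= y * z ^+ 2 by move=> y0; rewrite mulr_ge0 ?sqr_ge0.
  by apply: mulr_ge0; [exact: mulr_ge0 | apply: addr_ge0; exact: sq].
rewrite -subr_ge0.
have -> : c - (s * (A + B * d) ^+ 2 + k * (A' + B' * d) ^+ 2) =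
  (1 - l) * (c - (s * A ^+ 2 + k * A' ^+ 2)) +
  l * (c - (s * (A + B * D) ^+ 2 + k * (A' + B' * D) ^+ 2)) +
  l * (1 - l) * (s * (B * D) ^+ 2 + k * (B' * D) ^+ 2).
  by rewrite dE; ring.
by rewrite addr_ge0 // addr_ge0.
Qed.

(** Here -a is the local minimum, d the first upward step and k0, k1, k2 are the
damping factors at the minimum and at the two next indices; the conclusion says
that the energy two steps later is at most (1 - x^2) a^2.  This energy is convex
in d, so only the extreme steps matter: d = 0, and the d for which the step
before the minimum was 0.  Both cases describe two equal consecutive values, one
index apart, so that they lead to the same inequality, for (k1, k2) and for
(k0, k1). *)
Lemma damping_beats_sampling (R : realFieldType) (x k0 k1 k2 a d : R) :
  0 <= x < 1 -> 0 <= k0 -> k0 <= k1 -> k1 <= k2 -> k2 <= 1 -> 0 < k1 ->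
  0 <= a -> 0 <= d <= (1 - x) * (1 + k0) * a ->
  k1 ^+ 2 <= (1 - k2 ^+ 2) * (1 + x + k1 * x) ^+ 2 ->
  let w2 := d - a in
  let w3 := x * w2 + k1 * (x * w2 + a) in
  (1 - x ^+ 2) * w3 ^+ 2 + k2 ^+ 2 * (x * w3 - w2) ^+ 2 <= (1 - x ^+ 2) * a ^+ 2.
Proof.
move=> /andP[x0 x1] k00 k01 k12 k21 k1p a0 dD crit /=.
have s0 : 0 <= 1 - x ^+ 2 by apply/ltW/sqr_sin_gt0; lra.
have := @convex_le_of_endpoints R (x * (- a) + k1 * (x * (- a) + a)) (x + k1 * x)
  (x * (x * (- a) + k1 * (x * (- a) + a)) + a) (x * (x + k1 * x) - 1)
  (1 - x ^+ 2) (k2 ^+ 2) d _ ((1 - x ^+ 2) * a ^+ 2) s0 (sqr_ge0 _) dD.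
have -> : x * (- a) + k1 * (x * (- a) + a) + (x + k1 * x) * d
  = x * (d - a) + k1 * (x * (d - a) + a) by ring.
have -> : x * (x * (- a) + k1 * (x * (- a) + a)) + a + (x * (x + k1 * x) - 1) * d
  = x * (x * (d - a) + k1 * (x * (d - a) + a)) - (d - a) by ring.
apply.
- rewrite -subr_ge0.
  have -> : (1 - x ^+ 2) * a ^+ 2 -
   ((1 - x ^+ 2) * (x * - a + k1 * (x * - a + a)) ^+ 2 +
    k2 ^+ 2 * (x * (x * - a + k1 * (x * - a + a)) + a) ^+ 2)
   = (a * (1 - x)) ^+ 2 * ((1 - k2 ^+ 2) * (1 + x + k1 * x) ^+ 2 - k1 ^+ 2) by ring.
  by rewrite mulr_ge0 ?sqr_ge0 // subr_ge0.
set D := (1 - x) * (1 + k0) * a.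
have h2 : 0 <= 1 - k2 ^+ 2 by nra.
(* The criterion one index earlier, where the damping is stronger. *)
have crit0 : k0 ^+ 2 <= (1 - k1 ^+ 2) * (1 + x + k0 * x) ^+ 2.
  have e1 : (k0 * (1 + x + k1 * x)) ^+ 2 <= (k1 * (1 + x + k0 * x)) ^+ 2.
    rewrite ler_pXn2r ?nnegrE //; [nra| |]; rewrite mulr_ge0 //; nra.
  have e2 : 1 - k2 ^+ 2 <= 1 - k1 ^+ 2 by nra.
  rewrite -(ler_pM2l (_ : 0 < k1 ^+ 2)) ?exprn_gt0 //.
  apply: le_trans (_ : k0 ^+ 2 * ((1 - k2 ^+ 2) * (1 + x + k1 * x) ^+ 2) <= _).
    by rewrite mulrC ler_wpM2l ?sqr_ge0.
  apply: le_trans (_ : (1 - k2 ^+ 2) * (k1 * (1 + x + k0 * x)) ^+ 2 <= _).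
    by have := ler_wpM2l h2 e1; rewrite !exprMn mulrCA.
  have := ler_wpM2r (sqr_ge0 (k1 * (1 + x + k0 * x))) e2.
  by rewrite [in X in _ <= X -> _]exprMn [in X in _ <= X -> _]mulrCA.
rewrite -subr_ge0.
pose w2 := D - a; pose w3 := x * w2 + k1 * (x * w2 + a); pose t := x * w3 - w2.
have -> : (1 - x ^+ 2) * a ^+ 2 -
  ((1 - x ^+ 2) * (x * - a + k1 * (x * - a + a) + (x + k1 * x) * D) ^+ 2 +
   k2 ^+ 2 * (x * (x * - a + k1 * (x * - a + a)) + a + (x * (x + k1 * x) - 1) * D) ^+ 2)
  = (a * (1 - x)) ^+ 2 * ((1 - k1 ^+ 2) * (1 + x + k0 * x) ^+ 2 - k0 ^+ 2)
    + (1 - k2 ^+ 2) * t ^+ 2.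
  by rewrite /t /w3 /w2 /D; ring.
by rewrite addr_ge0 // mulr_ge0 ?sqr_ge0 // subr_ge0.
Qed.

(** The criterion of [damping_beats_sampling] is easier for smaller damping
factors and for larger x, so that it can be checked at a corner (x0, K). *)
Lemma criterion_mono (R : realFieldType) (x x0 k1 k2 K : R) :
  0 <= x0 <= x -> 0 < k1 -> k1 <= k2 -> k2 <= K -> K <= 1 ->
  K ^+ 2 <= (1 - K ^+ 2) * (1 + x0 + K * x0) ^+ 2 ->
  k1 ^+ 2 <= (1 - k2 ^+ 2) * (1 + x + k1 * x) ^+ 2.
Proof.
move=> /andP[x00 x0x] k1p k12 k2K K1 h.
have Kp : 0 < K by lra.
have h2 : 0 <= 1 - K ^+ 2 by nra.
have e1 : (k1 * (1 + x0 + K * x0)) ^+ 2 <= (K * (1 + x + k1 * x)) ^+ 2.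
  rewrite ler_pXn2r ?nnegrE //; [|rewrite mulr_ge0 //; nra..].
  have p1 := mulr_ge0 (ltW Kp) (_ : 0 <= x - x0).
  have p2 := mulr_ge0 (mulr_ge0 (ltW Kp) (ltW k1p)) (_ : 0 <= x - x0).
  move: p1 p2; rewrite subr_ge0 => /(_ x0x) p1 /(_ x0x) p2; nra.
have e2 : 1 - K ^+ 2 <= 1 - k2 ^+ 2 by nra.
rewrite -(ler_pM2l (_ : 0 < K ^+ 2)) ?exprn_gt0 //.
apply: le_trans (_ : k1 ^+ 2 * ((1 - K ^+ 2) * (1 + x0 + K * x0) ^+ 2) <= _).
  by rewrite mulrC ler_wpM2l ?sqr_ge0.
apply: le_trans (_ : (1 - K ^+ 2) * (K * (1 + x + k1 * x)) ^+ 2 <= _).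
  by have := ler_wpM2l h2 e1; rewrite !exprMn mulrCA.
have := ler_wpM2r (sqr_ge0 (K * (1 + x + k1 * x))) e2.
by rewrite [in X in _ <= X -> _]exprMn [in X in _ <= X -> _]mulrCA.
Qed.

(** Strong damping (small k2) makes the criterion hold already for x = 0.
Weak damping means that m is large compared with r, and then the bound on
1 - x pushes x towards 1.  Six corners (K, x0) cover the range m <= 12 r. *)
Lemma criterion_of_bound (R : realFieldType) (r x m : R) :
  1 <= r -> x < 1 -> 4 <= m -> m <= 12 * r ->
  (1 - x) * (4 * (m - 1) * (m + r) + (r + 2) * (r + 3)) <= (r + 5) ^+ 2 ->
  let k1 := (m + 1) / (m + 1 + r) in let k2 := (m + 2) / (m + 2 + r) in
  0 <= x /\ k1 ^+ 2 <= (1 - k2 ^+ 2) * (1 + x + k1 * x) ^+ 2.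
Proof.
move=> r1 x1 m4 mr bnd k1 k2.
have k1p : 0 < k1 by rewrite divr_gt0 //; lra.
have k12 : k1 <= k2.
  by rewrite /k1 /k2 ler_pdivrMr ?[_ / _ * _]mulrAC ?ler_pdivlMr; [nra|lra..].
have k2K K : 0 < K -> (k2 <= K) = ((m + 2) * (1 - K) <= K * r).
  move=> K0; rewrite /k2 ler_pdivrMr; last lra.
  by apply/idP/idP; nra.
have xlow y : 0 < y -> (r + 5) ^+ 2 <= y * (4 * (m - 1) * (m + r) + (r + 2) * (r + 3)) ->
    1 - y <= x.
  move=> y0 hy; set Q := 4 * _ * _ + _ in bnd hy.
  have Q0 : 0 < Q by rewrite /Q; nra.
  by rewrite -(ler_pM2r Q0); nra.
have piece K x0 : 0 <= x0 -> x0 <= x -> k2 <= K -> K <= 1 ->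
  K ^+ 2 <= (1 - K ^+ 2) * (1 + x0 + K * x0) ^+ 2 ->
  0 <= x /\ k1 ^+ 2 <= (1 - k2 ^+ 2) * (1 + x + k1 * x) ^+ 2.
  move=> a b c d e; split; first lra.
  by apply: (@criterion_mono _ x x0 k1 k2 K) => //; rewrite a b.
have x0 : 0 <= x.
  by have := xlow 1; rewrite subrr; apply; clear -r1 m4 mr; nra.
(* 1 - y is the lower bound for x at the corner K. *)
have step K y : 0 < y < 1 -> K <= 1 ->
    K ^+ 2 <= (1 - K ^+ 2) * (1 + (1 - y) + K * (1 - y)) ^+ 2 ->
    (r + 5) ^+ 2 <= y * (4 * (m - 1) * (m + r) + (r + 2) * (r + 3)) ->
    k2 <= K ->
    0 <= x /\ k1 ^+ 2 <= (1 - k2 ^+ 2) * (1 + x + k1 * x) ^+ 2.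
  move=> /andP[y0 y1] K1 hK hy kK; apply: (piece K (1 - y)) => //; first lra.
  exact: xlow.
have split K : 0 < K -> k2 <= K \/ K * r < (m + 2) * (1 - K).
  by move=> K0; have [|] := lerP k2 K; [left|rewrite ltNge k2K // -ltNge; right].
have [h|h] := split (7/10) ltac:(clear; lra).
  by apply: (piece _ 0 _ _ h) => //; clear; lra.
have [h'|h'] := split (82/100) ltac:(clear; lra).
  by apply: (step _ (3/4) _ _ _ _ h'); first [clear; lra | clear -r1 m4 h; nra].
have [h2|h2] := split (865/1000) ltac:(clear; lra).
  by apply: (step _ (3/5) _ _ _ _ h2); first [clear; lra | clear -r1 m4 h'; nra].
have [h3|h3] := split (89/100) ltac:(clear; lra).
  by apply: (step _ (45/100) _ _ _ _ h3); first [clear; lra | clear -r1 m4 h2; nra].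
have [h4|h4] := split (917/1000) ltac:(clear; lra).
  by apply: (step _ (1/4) _ _ _ _ h4); first [clear; lra | clear -r1 m4 h3; nra].
apply: (step (14/15) (15/100)); try by [clear; lra | clear -r1 m4 h4; nra].
by rewrite k2K; [clear -r1 mr; lra | clear; lra].
Qed.

Lemma u2E (R : realFieldType) (r x : R) (u : nat -> R) :
  1 <= r -> gegenbauer_seq r x u ->
  u 2%N = ((r + 2) * x ^+ 2 - 1) / (r + 1).
Proof.
move=> r1 hu; rewrite (gegenbauer_next 0 r1 hu); case: hu => -> -> _.
by field; rewrite !gt_eqF //=; lra.
Qed.

Lemma u3E (R : realFieldType) (r x : R) (u : nat -> R) :
  1 <= r -> gegenbauer_seq r x u ->
  u 3%N = x * ((r + 4) * x ^+ 2 - 3) / (r + 1).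
Proof.
move=> r1 hu; rewrite (gegenbauer_next 1 r1 hu) (u2E r1 hu); case: hu => _ -> _.
by field; rewrite !gt_eqF //=; lra.
Qed.

(** At index 3 the bound of [decreasing_run_bound] is slightly too weak for r
near 1; the exact form of u 3 <= u 2 is used instead.  It gives x >= 1/4 or
r >= 4. *)
Lemma criterion_at_3 (R : realFieldType) (r x : R) :
  1 <= r -> 0 <= x -> 0 <= (r + 4) * x ^+ 2 + 2 * x - 1 ->
  (4 / (4 + r)) ^+ 2 <= (1 - (5 / (5 + r)) ^+ 2) * (1 + x + 4 / (4 + r) * x) ^+ 2.
Proof.
move=> r1 x0 h.
have [x4|x4] := lerP (1 / 4) x; last first.
  have r4 : 4 <= r by rewrite leNgt; apply/negP => r4; nra.
  apply: (@criterion_mono _ _ 0 _ _ (5 / 9)); first by rewrite lexx.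
  - by rewrite divr_gt0 //; lra.
  - by rewrite ler_pdivrMr ?[_ / _ * _]mulrAC ?ler_pdivlMr; lra.
  - by rewrite ler_pdivrMr; lra.
  - by lra.
  - by lra.
have -> : 1 - (5 / (5 + r)) ^+ 2 = r * (10 + r) / (5 + r) ^+ 2.
  by field; rewrite gt_eqF //; lra.
have -> : 1 + x + 4 / (4 + r) * x = (4 + r + x * (8 + r)) / (4 + r).
  by field; rewrite gt_eqF //; lra.
rewrite !expr_div_n mulrA ler_pM2r ?invr_gt0 ?exprn_gt0 //; last lra.
rewrite mulrAC ler_pdivlMr ?exprn_gt0 //; last lra.
have h1 : (6 + 5 / 4 * r) ^+ 2 <= (4 + r + x * (8 + r)) ^+ 2.
  by rewrite ler_pXn2r ?nnegrE //; nra.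
apply: le_trans (_ : r * (10 + r) * (6 + 5 / 4 * r) ^+ 2 <= _).
  have [b b0 ->] : exists2 b, 0 <= b & r = 1 + b by exists (r - 1); lra.
  clear -b0; rewrite -subr_ge0.
  have -> : (1 + b) * (10 + (1 + b)) * (6 + 5 / 4 * (1 + b)) ^+ 2 - 4 ^+ 2 * (5 + (1 + b)) ^+ 2
    = 35/16 + 5105/8 * b + 1085/4 * b ^+ 2 + 295/8 * b ^+ 3 + 25/16 * b ^+ 4 by field.
  have b2 := exprn_ge0 2 b0; have b3 := exprn_ge0 3 b0; have b4 := exprn_ge0 4 b0.
  by lra.
by apply: ler_wpM2l; nra.
Qed.

Lemma min_of_criterion (R : realFieldType) (r x : R) (u : nat -> R) (m : nat) :
  1 <= r -> 0 <= x < 1 -> gegenbauer_seq r x u ->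
  (forall n, (n <= m)%N -> u n.+1 <= u n) -> u m.+1 < 0 -> u m.+1 <= u m.+2 ->
  let k1 := (m.+1%:R + 1) / (m.+1%:R + 1 + r) in
  let k2 := (m.+1%:R + 2) / (m.+1%:R + 2 + r) in
  k1 ^+ 2 <= (1 - k2 ^+ 2) * (1 + x + k1 * x) ^+ 2 ->
  forall n, u m.+1 <= u n.
Proof.
move=> r1 /andP[x0 x2] hu mono uneg up k1 k2 crit.
pose j : R := m.+1%:R; rewrite -/j in k1 k2 crit.
have j1 : 1 <= j by rewrite /j ler1n.
pose k0 := j / (j + r).
have kle (y : R) : 0 <= y -> y / (y + r) <= (y + 1) / (y + 1 + r).
  by move=> y0; rewrite ler_pdivrMr ?[_ / _ * _]mulrAC ?ler_pdivlMr; [nra|lra..].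
have k00 : 0 <= k0 by rewrite divr_ge0 //; lra.
have k01 : k0 <= k1 by apply: kle; lra.
have k12 : k1 <= k2.
  have -> : k2 = (j + 1 + 1) / (j + 1 + 1 + r) by rewrite /k2 -[j + 1 + 1]addrA.
  by apply: kle; lra.
have k21 : k2 <= 1 by rewrite ler_pdivrMr; lra.
have k1p : 0 < k1 by rewrite divr_gt0 //; lra.
have e2 := gegenbauer_next m r1 hu.
have e3 := gegenbauer_next m.+1 r1 hu.
have e4 := gegenbauer_next m.+2 r1 hu.
have dec := mono m (leqnn m).
have nE : m.+2%:R = j + 1 by rewrite /j natr1.
have nE' : m.+3%:R = j + 2 by rewrite -natr1 nE -addrA.
rewrite nE -/k1 in e3; rewrite nE' -/k2 in e4; rewrite -/j -/k0 in e2.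
pose a := - u m.+1; pose d := u m.+2 - u m.+1.
have x11 : -1 < x < 1 by rewrite x2 andbT; lra.
apply: (@energy_trap _ r x u m.+1 m.+3) => //.
  by move=> n; rewrite ltnS => nn; have -> : n = m.+2 by apply/eqP; rewrite eqn_leq andbC.
have := @damping_beats_sampling R x k0 k1 k2 a d _ k00 k01 k12 k21 k1p _ _ crit.
rewrite x0 x2 => /(_ isT) /= H.
have : (1 - x ^+ 2) * (x * (d - a) + k1 * (x * (d - a) + a)) ^+ 2 +
    k2 ^+ 2 * (x * (x * (d - a) + k1 * (x * (d - a) + a)) - (d - a)) ^+ 2 <=
    (1 - x ^+ 2) * a ^+ 2.
  apply: H; first by rewrite /a; lra.
  rewrite /d subr_ge0 up /= e2 /a; have := ler_wpM2l k00 dec; clear; nra.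
have -> : d - a = u m.+2 by rewrite /d /a; ring.
have -> : x * u m.+2 + k1 * (x * u m.+2 + a) = u m.+3 by rewrite e3 /a; ring.
rewrite /energy e4 /a; set y := u m.+3; set z := u m.+2; clear; nra.
Qed.

Lemma first_min_moderate (R : realFieldType) (r x : R) (u : nat -> R) (j : nat) :
  1 <= r -> -1 < x < 1 -> gegenbauer_seq r x u -> (3 <= j)%N -> j%:R <= 12 * r ->
  (forall n, (n < j)%N -> u n.+1 <= u n) -> u j < 0 -> u j <= u j.+1 ->
  forall n, u j <= u n.
Proof.
move=> r1 /andP[x1 x2] hu; case: j => [//|[//|[//|m]]] _ jr mono uneg up.
have m0 := ler0n R m.
have jE : m.+3%:R = m%:R + 3 :> R by rewrite -!natr1; ring.
have bnd := @decreasing_run_bound _ _ _ _ m.+1 r1 x2 hu mono.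
suff [x0 crit] : 0 <= x /\
    ((m.+3%:R + 1) / (m.+3%:R + 1 + r)) ^+ 2
    <= (1 - ((m.+3%:R + 2) / (m.+3%:R + 2 + r)) ^+ 2)
       * (1 + x + (m.+3%:R + 1) / (m.+3%:R + 1 + r) * x) ^+ 2.
  by apply: (min_of_criterion r1 _ hu mono uneg up crit); rewrite x0.
have [m0E|mpos] := posnP m.
  have x0 : 0 <= x by move: bnd; rewrite m0E; clear -r1 x2; nra.
  split=> //; rewrite jE m0E add0r.
  have -> : 3 + 1 = 4 :> R by ring.
  have -> : 3 + 2 = 5 :> R by ring.
  apply: criterion_at_3 => //.
  have := mono 2%N isT; rewrite (u2E r1 hu) (u3E r1 hu).
  rewrite ler_pdivrMr ?divfK; [|by rewrite gt_eqF //; lra|lra].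
  have e : 0 < 1 - x by lra.
  move=> h; rewrite -(pmulr_rge0 _ e); move: h; clear; nra.
have m1 : 1 <= m%:R :> R by rewrite ler1n.
apply: criterion_of_bound => //; first by rewrite jE; lra.
by move: bnd; rewrite jE -!natr1; congr (_ <= _); ring.
Qed.

(** * Long first descents *)

(** While u stays below half of its minimum, the restoring term feeds the upward
step at each index; the steps grow at least linearly. *)
Lemma ascent_growth (R : realFieldType) (r x : R) (u : nat -> R) (j i : nat) :
  1 <= r -> x < 1 -> gegenbauer_seq r x u -> u j < 0 -> u j <= u j.+1 ->
  (forall l, (l <= i)%N -> u (j + l)%N <= u j / 2) ->
  (1 - x) / (1 + r) * (- u j) * i%:R <= u (j + i).+1 - u (j + i)%N.
Proof.
move=> r1 x1 hu uneg up; have r0 : 0 < 1 + r by lra.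
elim: i => [_|i IH low]; first by rewrite mulr0 addn0 subr_ge0.
have {}IH := IH (fun l li => low l (leqW li)).
have := low i.+1 (leqnn _); case: hu => _ _ /(_ (j + i)%N).
rewrite addnS -natr1 natrD -[i.+1%:R]natr1.
move: IH; set a := u j; set w1 := u (j + i)%N; set w2 := u (j + i).+1.
set w3 := u (j + i).+2; set J := j%:R; set I := i%:R.
have J0 : 0 <= J by exact: ler0n.
have I0 : 0 <= I by exact: ler0n.
pose c := (1 - x) / (1 + r) * (- a).
have cE : c * (1 + r) = (1 - x) * (- a) by rewrite /c mulrAC divfK // gt_eqF.
have c0 : 0 <= c by rewrite mulr_ge0 ?divr_ge0 // /a; lra.
rewrite -/c => IH rec low2.
have k0 : 0 < J + I + 1 + r by lra.
rewrite -(ler_pM2l k0).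
have -> : (J + I + 1 + r) * (w3 - w2) =
    (J + I + 1) * (w2 - w1) - (1 - x) * (2 * (J + I + 1) + r) * w2.
  by move: rec; clear; lra.
have p1 := ler_wpM2l (_ : 0 <= J + I + 1) IH.
have p2 : 0 <= (1 - x) * (2 * (J + I + 1) + r) * (a / 2 - w2).
  by apply: mulr_ge0; [apply: mulr_ge0|]; lra.
(* The slack left by the constant 1 / (1 + r). *)
have p3 : 0 <= c * (r * J + r ^+ 2 / 2 + r / 2).
  by apply: mulr_ge0 => //; clear -J0 r1; nra.
have {}p1 := p1 ltac:(lra).
have p4 : (c * (1 + r)) * (2 * (J + I + 1) + r) = (1 - x) * (- a) * (2 * (J + I + 1) + r).
  by rewrite cE.
clear -p1 p2 p3 p4; lra.
Qed.

Lemma ascent_height (R : realFieldType) (r x : R) (u : nat -> R) (j i : nat) :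
  1 <= r -> x < 1 -> gegenbauer_seq r x u -> u j < 0 -> u j <= u j.+1 ->
  (forall l, (l < i)%N -> u (j + l)%N <= u j / 2) ->
  (1 - x) / (1 + r) * (- u j) * (i%:R * (i%:R - 1) / 2) <= u (j + i)%N - u j.
Proof.
move=> r1 x1 hu uneg up; elim: i => [_|i IH low].
  by rewrite addn0 subrr mul0r mul0r mulr0.
have h1 := IH (fun l li => low l (ltnW li)).
have h2 := ascent_growth r1 x1 hu uneg up (low : forall l, (l <= i)%N -> _).
have -> : i.+1%:R * (i.+1%:R - 1) / 2 = i%:R * (i%:R - 1) / 2 + i%:R :> R.
  by rewrite -natr1; field.
rewrite mulrDr addnS.
have -> : u (j + i).+1 - u j = (u (j + i)%N - u j) + (u (j + i).+1 - u (j + i)%N) by ring.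
exact: lerD.
Qed.

(** Let N be the first index after j at which u exceeds u j / 2.  By
[ascent_height] the climb takes at most about sqrt ((1 + r) / (1 - x)) steps,
hence (1 - x) (N + r) is at most a fixed multiple of r.  At N, where u is small,
the square of the damped coordinate is at least 3/4 (1 - x^2) (u j)^2, and the
loss there exceeds the sampling error (1 - x)^2 (u j)^2. *)
Lemma first_min_large (R : realFieldType) (r x : R) (u : nat -> R) (j : nat) :
  1 <= r -> -1 < x < 1 -> gegenbauer_seq r x u -> 12 * r <= j%:R ->
  (forall n, (n < j)%N -> u n.+1 <= u n) -> u j < 0 -> u j <= u j.+1 ->
  forall n, u j <= u n.
Proof.
move=> r1 x11 hu jr mono uneg up n.
have /andP[x1 x2] := x11; have s0 := sqr_sin_gt0 x11.
have [nj|jn] := leqP n j.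
  have dec m l : (m + l <= j)%N -> u (m + l)%N <= u m.
    elim: l => [|l IH ml]; first by rewrite addn0.
    rewrite addnS; apply: le_trans (mono _ _) (IH _); first by rewrite -addnS.
    by apply: leq_trans ml; rewrite addnS.
  by rewrite -{1}(subnKC nj) dec // subnKC.
pose e := 1 - x; pose a := - u j; pose J : R := j%:R.
have a0 : 0 < a by rewrite /a; lra.
have e0 : 0 < e by rewrite /e; lra.
have rise i : (forall l, (l < i)%N -> u (j + l)%N <= u j / 2) ->
    u j <= u (j + i)%N.
  move=> low; rewrite -subr_ge0; apply: le_trans (ascent_height r1 x2 hu uneg up low).
  apply: mulr_ge0; first by rewrite mulr_ge0 ?divr_ge0 //; lra.
  case: i {low} => [|i]; first by rewrite !mul0r.
  by rewrite divr_ge0 // mulr_ge0 // -natr1 addrK.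
have [/existsP[i0 hi0]|] := boolP [exists i : 'I_n.+1, u j / 2 < u (j + i)%N]; last first.
  rewrite negb_exists => /forallP low; rewrite -(subnKC (ltnW jn)).
  apply: rise => l ln; have lt : (l < n.+1)%N.
    exact: ltnW (leq_trans ln (leq_subr j n)).
  by have := low (Ordinal lt); rewrite -leNgt.
have exP : exists i, u j / 2 < u (j + i)%N by exists i0.
case: (ex_minnP exP) => [[|I]] hI minI {i0 hi0 exP}.
  by move: hI; rewrite addn0; lra.
have low l : (l <= I)%N -> u (j + l)%N <= u j / 2.
  by move=> lI; rewrite leNgt; apply/negP => /minI; rewrite ltnNge lI.
have mid l : (j < l < j + I.+1)%N -> u j <= u l.
  move=> /andP[jl lI]; rewrite -(subnKC (ltnW jl)); apply: rise => l' h'.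
  apply: low; rewrite -ltnS -(ltn_add2l j); apply: ltn_trans lI.
  by rewrite -ltn_subRL.
have j12 : 12 <= J by rewrite /J; lra.
have [m jm] : exists m, j = m.+2.
  exists (j - 2)%N; rewrite -addn2 subnK // -(ler_nat R) -/J; lra.
have bnd := @decreasing_run_bound R r x u m r1 x2 hu.
have {}bnd : e * (4 * (J - 1) * (J + r) + (r + 2) * (r + 3)) <= (r + 5) ^+ 2.
  have -> : J = m%:R + 2 by rewrite /J jm -!natr1; ring.
  have -> : m%:R + 2 - 1 = m%:R + 1 :> R by ring.
  by apply: bnd => l lm; apply: mono; rewrite jm ltnS.
have jr' : 12 * r <= J by [].
have B36 : (r + 5) ^+ 2 <= 36 * r ^+ 2 by clear -r1; nra.
(* b1 and b2 rest on (r + 5)^2 <= 36 r^2 and 4 (J - 1) >= 44 r. *)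
have b1 : e * (J + r) <= 82 / 100 * r.
  have q1 : e * (J + r) * (44 * r) <= 36 * r ^+ 2.
    apply: le_trans B36; apply: le_trans bnd; rewrite -mulrA.
    by apply: ler_wpM2l; [exact: ltW | clear -r1 jr'; nra].
  have r0 : 0 < r by lra.
  have : e * (J + r) * 44 <= 36 * r by rewrite -(ler_pM2r r0); move: q1; clear; nra.
  lra.
have b2 : e * 13 <= 82 / 100.
  have r0 : 0 < r by lra.
  rewrite -(ler_pM2r r0); apply: le_trans b1; rewrite -mulrA.
  by apply: ler_wpM2l; [exact: ltW | lra].
(* (1 - x^2) + (1 - x)^2 = 2 (1 - x): the sampling error is included. *)
have hE : energy x u (j + I) <= 2 * e * a ^+ 2.
  apply: (le_trans (energy_le r1 hu (leq_addr I j))).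
  have low0 : - (e * a) <= u j.+1 - x * u j by rewrite /e /a; lra.
  have hi0 : u j.+1 - x * u j <= e * a.
    have := mono m.+1; rewrite jm ltnSn => /(_ isT) dec.
    rewrite (gegenbauer_next m.+1 r1 hu) addrC addKr /e /a jm.
    have k0 : 0 <= m.+2%:R / (m.+2%:R + r) <= 1.
      have := ltr0Sn R m.+1 => n0; apply/andP; split; first by rewrite divr_ge0 //; lra.
      by rewrite ler_pdivrMr; lra.
    move: k0; set k := _ / _; move: dec uneg; rewrite jm.
    set w0 := u m.+1; set w1 := u m.+2; clear -x2 => dec w1n /andP[k0 k1].
    have := mulr_ge0 k0 (_ : 0 <= w0 - w1); rewrite subr_ge0 => /(_ dec).
    have := mulr_ge0 (_ : 0 <= 1 - k) (_ : 0 <= (1 - x) * (- w1)).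
    by move=> /(_ ltac:(lra) ltac:(rewrite mulr_ge0 //; lra)); nra.
  have : (u j.+1 - x * u j) ^+ 2 <= (e * a) ^+ 2.
    by clear -low0 hi0; nra.
  rewrite /energy /e /a; clear; nra.
have x0 : 0 <= x by rewrite /e in b2; lra.
(* If the energy is already low the trap closes before N = j + I + 1. *)
have [small|big] := lerP (energy x u (j + I)) ((1 - x ^+ 2) * a ^+ 2).
  rewrite /a sqrrN in small.
  apply: (@energy_trap _ r x u j (j + I) r1 x11 hu uneg mono) => //.
  by move=> l /andP[jl lI]; apply: mid; rewrite jl /= addnS ltnS ltnW.
apply: (@energy_trap _ r x u j (j + I.+1) r1 x11 hu uneg mono mid) => //.
have hI2 : (e * (I%:R - 1)) ^+ 2 <= e * (1 + r).
  have := ascent_height r1 x2 hu uneg up (fun l li => low l (ltnW li)).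
  have := low I (leqnn I); rewrite -/e -/a => l1.
  have r0 : 0 < 1 + r by lra.
  move=> l2; have {l2} : e / (1 + r) * a * (I%:R * (I%:R - 1) / 2) <= a / 2.
    by apply: le_trans l2 _; move: l1; rewrite /a; lra.
  have -> : e / (1 + r) * a * (I%:R * (I%:R - 1) / 2) = a / 2 * (e * (I%:R * (I%:R - 1)) / (1 + r)).
    by field; rewrite gt_eqF.
  rewrite ger_pMr ?divr_gt0 // ler_pdivrMr // mul1r => l2.
  have : e * (e * (I%:R * (I%:R - 1))) <= e * (1 + r) by rewrite ler_wpM2l // ltW.
  have := ler0n R I; case: (I) => [|I'].
    rewrite sub0r mul0r mulr0 mulr0 => _ _.
    by rewrite mulrN1 sqrrN expr2 ler_wpM2l //; [lra | clear -b2 r1; lra].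
  rewrite -natr1 addrK; have := ler0n R I'; clear -e0; nra.
have hI3 : e * (I%:R - 1) <= 36 / 100 * r.
  rewrite leNgt; apply/negP => lt; have : (36 / 100 * r) ^+ 2 < (e * (I%:R - 1)) ^+ 2.
    by rewrite ltr_pXn2r ?nnegrE //; lra.
  clear -hI2 b2 r1; nra.
pose N : R := (j + I.+1)%:R.
have NE : N = J + I%:R + 1 by rewrite /N /J addnS -natr1 natrD.
have N0 : 0 <= N by exact: ler0n.
have eN : e * (N + r) <= 1425 / 1000 * r by rewrite NE; clear -b1 b2 hI3 r1; lra.
(* The small energy also prevents u from jumping over the interval
   around 0 in one step. *)
have u0 : u (j + I.+1)%N <= a / 2.
  rewrite leNgt; apply/negP => lt.
  have l1 := low I (leqnn I); rewrite addnS in lt hI.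
  have : energy x u (j + I) = (1 - x ^+ 2) * u (j + I)%N ^+ 2
      + (u (j + I).+1 - x * u (j + I)%N) ^+ 2 by rewrite /energy; ring.
  have h1 : a / 2 < u (j + I).+1 - x * u (j + I)%N.
    have : 0 <= x * (- u (j + I)%N).
      by rewrite mulr_ge0 //; clear -l1 a0; rewrite /a in a0; lra.
    clear -lt; lra.
  have h2 : (a / 2) ^+ 2 < (u (j + I).+1 - x * u (j + I)%N) ^+ 2.
    by rewrite ltr_pXn2r ?nnegrE //; clear -a0 h1; lra.
  have h3 : 0 <= (1 - x ^+ 2) * u (j + I)%N ^+ 2 by rewrite mulr_ge0 ?sqr_ge0 // ltW.
  have h4 : 0 <= (1 / 8 - e) * a ^+ 2 by clear -b2; rewrite mulr_ge0 ?sqr_ge0 //; lra.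
  clear -hE h2 h3 h4; lra.
have step := energy_step (j + I) hu.
rewrite -addnS -/N in step.
have wE : energy x u (j + I) = (1 - x ^+ 2) * u (j + I.+1)%N ^+ 2
    + (x * u (j + I.+1)%N - u (j + I)%N) ^+ 2 by rewrite /energy addnS; ring.
have w2 : u (j + I.+1)%N ^+ 2 <= (a / 2) ^+ 2.
  by move: hI u0; rewrite /a; clear; nra.
have t2 : (1 - x ^+ 2) * (3 / 4 * a ^+ 2) <= (x * u (j + I.+1)%N - u (j + I)%N) ^+ 2.
  have := ler_wpM2l (ltW s0) w2; move: wE big; clear; nra.
have Nr : 0 < N + r by clear -N0 r1; lra.
have k2 : 0 < (N + r) ^+ 2 by rewrite exprn_gt0.
have ua : u j ^+ 2 = a ^+ 2 by rewrite /a sqrrN.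
rewrite -(ler_pM2l k2) ua.
have c0 : 0 <= r * (2 * N + r) by clear -N0 r1; rewrite mulr_ge0 //; lra.
have := ler_wpM2l c0 t2; rewrite -step => loss.
have top := ler_wpM2l (ltW k2) hE.
have e8 : 0 <= e * a ^+ 2 by rewrite mulr_ge0 ?sqr_ge0 // ltW.
suff key : e * (N + r) ^+ 2 <= r * (2 * N + r) * (2 - e) * (3 / 4).
  have := ler_wpM2l e8 key.
  have -> : 1 - x ^+ 2 = e * (2 - e) by rewrite /e; ring.
  rewrite (_ : 1 - x ^+ 2 = e * (2 - e)) in loss; last by rewrite /e; ring.
  move: loss top; clear; nra.
have -> : e * (N + r) ^+ 2 = e * (N + r) * (N + r) by ring.
apply: le_trans (ler_wpM2r (ltW Nr) eN) _.
clear -N0 r1 b2 c0 e0.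
have q : 0 <= r * N by rewrite mulr_ge0 //; lra.
have q2 := mulr_ge0 c0 (_ : 0 <= 2 - e - 19 / 10).
have {}q2 := q2 ltac:(lra).
by clear -q q2 r1; nra.
Qed.

(** * Descents of length one and two *)

Lemma u4E (R : realFieldType) (r x : R) (u : nat -> R) :
  1 <= r -> gegenbauer_seq r x u ->
  u 4%N = ((r + 4) * (r + 6) * x ^+ 4 - 6 * (r + 4) * x ^+ 2 + 3)
          / ((r + 1) * (r + 3)).
Proof.
move=> r1 hu; rewrite (gegenbauer_next 2 r1 hu) (u3E r1 hu) (u2E r1 hu).
by field; rewrite !gt_eqF //=; lra.
Qed.

Lemma u5E (R : realFieldType) (r x : R) (u : nat -> R) :
  1 <= r -> gegenbauer_seq r x u ->
  u 5%N = x * ((r + 6) * (r + 8) * x ^+ 4 - 10 * (r + 6) * x ^+ 2 + 15)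
          / ((r + 1) * (r + 3)).
Proof.
move=> r1 hu; rewrite (gegenbauer_next 3 r1 hu) (u4E r1 hu) (u3E r1 hu).
by field; rewrite !gt_eqF //=; lra.
Qed.

Lemma u6E (R : realFieldType) (r x : R) (u : nat -> R) :
  1 <= r -> gegenbauer_seq r x u ->
  u 6%N = ((r + 6) * (r + 8) * (r + 10) * x ^+ 6
           - 15 * (r + 6) * (r + 8) * x ^+ 4 + 45 * (r + 6) * x ^+ 2 - 15)
          / ((r + 1) * (r + 3) * (r + 5)).
Proof.
move=> r1 hu; rewrite (gegenbauer_next 4 r1 hu) (u5E r1 hu) (u4E r1 hu).
by field; rewrite !gt_eqF //=; lra.
Qed.

(** The gap between (1 - x^2) (u 1)^2 and the energy at index 4, without its
trivial factors, as a polynomial in X = x^2; similarly [margin2] for u 2. *)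
Definition margin1 (R : realFieldType) (r X : R) : R :=
  - 9 + r * X * (60 - 192 * X + 288 * X ^+ 2)
  + r ^+ 2 * X * (22 - 20 * X + 132 * X ^+ 2)
  + r ^+ 3 * X * (8 + 8 * X + 20 * X ^+ 2) + r ^+ 4 * X * (1 + X + X ^+ 2).

Definition margin2 (R : realFieldType) (r X : R) : R :=
  6 * r + r ^+ 2 - (2 * r ^+ 3 + 15 * r ^+ 2 + 36) * X
  - (192 * r + 20 * r ^+ 2 - 8 * r ^+ 3 - r ^+ 4) * X ^+ 2
  + (288 * r + 132 * r ^+ 2 + 20 * r ^+ 3 + r ^+ 4) * X ^+ 3.

Lemma energy4_margin1 (R : realFieldType) (r x : R) (u : nat -> R) :
  1 <= r -> gegenbauer_seq r x u ->
  (1 - x ^+ 2) * u 1%N ^+ 2 - energy x u 4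
  = (1 - x ^+ 2) ^+ 2 * margin1 r (x ^+ 2) / ((r + 1) * (r + 3)) ^+ 2.
Proof.
move=> r1 hu; rewrite /energy /margin1 (u5E r1 hu) (u4E r1 hu).
case: hu => _ -> _.
by field; rewrite !gt_eqF //=; lra.
Qed.

Lemma energy4_margin2 (R : realFieldType) (r x : R) (u : nat -> R) :
  1 <= r -> gegenbauer_seq r x u ->
  (1 - x ^+ 2) * u 2%N ^+ 2 - energy x u 4
  = (1 - x ^+ 2) ^+ 2 * margin2 r (x ^+ 2) / ((r + 1) * (r + 3)) ^+ 2.
Proof.
move=> r1 hu; rewrite /energy /margin2 (u5E r1 hu) (u4E r1 hu) (u2E r1 hu).
by field; rewrite !gt_eqF //=; lra.
Qed.

(** For r near 1 and x^2 near 1/9 the energy at index 4 is still too large.  The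
damping at index 5 is negligible there, that at index 6 is what helps. *)
Lemma energy_drop6 (R : realFieldType) (r x : R) (u : nat -> R) :
  1 <= r <= 6 / 5 -> gegenbauer_seq r x u -> 9 / 100 <= x ^+ 2 <= 1 / 8 ->
  energy x u 6 <= energy x u 4 - 71 / 10 * x ^+ 2 / ((r + 1) * (r + 3)) ^+ 2.
Proof.
move=> /andP[r1 r2] hu /andP[X1 X2].
apply: le_trans (_ : energy x u 5 - 71 / 10 * x ^+ 2 / ((r + 1) * (r + 3)) ^+ 2 <= _);
  last by rewrite lerD2r (energy_le r1 hu).
have h := energy_step 5 hu.
have r6 : 0 < (6 + r) ^+ 2 by rewrite exprn_gt0 //; lra.
rewrite lerBrDl -lerBrDr -(ler_pM2l r6) h (u5E r1 hu) (u6E r1 hu).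
(* Up to explicit factors, k is the damped coordinate x u 6 - u 5. *)
pose k := 15 - 5 * (2 * r + 19) * x ^+ 2 + (r + 8) * (r + 20) * (x ^+ 2) ^+ 2
  - (r + 8) * (r + 10) * (x ^+ 2) ^+ 3.
have k1 : 445 / 100 <= k.
  rewrite /k; move: X1 X2; set X := x ^+ 2; clear -r1 r2 => X1 X2.
  have h1 : 0 <= (r + 8) * (r + 10) * (X ^+ 2 * (1 / 8 - X)).
    apply: mulr_ge0; first by apply: mulr_ge0; lra.
    by apply: mulr_ge0; [exact: sqr_ge0 | lra].
  have h2 : 0 <= (r + 8) * (7 * r + 150) / 8 * (X - 1 / 8) ^+ 2.
    apply: mulr_ge0 (sqr_ge0 _); rewrite divr_ge0 //.
    by apply: mulr_ge0; lra.
  have h3 : 0 <= (5 * (2 * r + 19) - (r + 8) * (7 * r + 150) / 32) * (1 / 8 - X).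
    by apply: mulr_ge0; nra.
  by nra.
have k2 : 71 / 10 * (r + 5) ^+ 2 <= r * (12 + r) * k ^+ 2.
  have : (445 / 100) ^+ 2 <= k ^+ 2 by clear -k1; nra.
  by clear -r1 r2; nra.
set L := _ * _; set M := r * _ * _.
have -> : L = (6 + r) ^+ 2 * x ^+ 2 / ((r + 1) * (r + 3) * (r + 5)) ^+ 2
     * (71 / 10 * (r + 5) ^+ 2).
  by rewrite /L; field; rewrite !gt_eqF //=; lra.
have -> : M = (6 + r) ^+ 2 * x ^+ 2 / ((r + 1) * (r + 3) * (r + 5)) ^+ 2
     * (r * (12 + r) * k ^+ 2).
  by rewrite /M /k; field; rewrite !gt_eqF //=; lra.
apply: ler_wpM2l k2; apply: divr_ge0; last exact: sqr_ge0.
by apply: mulr_ge0; exact: sqr_ge0.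
Qed.

(** The margin is increasing in X on the whole range, so the worst X is
1 / (r + 2)^2, where u 1 = u 2.  At r = 1 it is negative there, which explains
the side condition. *)
Lemma margin1_ge0 (R : realFieldType) (r X : R) :
  1 <= r -> X <= 1 -> 1 <= (r + 2) ^+ 2 * X -> 6 / 5 <= r \/ 1 / 8 <= X ->
  0 <= margin1 r X.
Proof.
move=> r1 X1 qX cond.
have X0 : 0 < X by clear -r1 qX; nra.
have c2 : 0 <= 132 * X ^+ 2 - 20 * X + 22 - 212 / 10.
  by have := sqr_ge0 (X - 5 / 66); clear; lra.
have m2 : 212 / 10 * r ^+ 2 * X <= r ^+ 2 * X * (22 - 20 * X + 132 * X ^+ 2).
  have := mulr_ge0 (mulr_ge0 (sqr_ge0 r) (ltW X0)) c2; clear; lra.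
have m3 : 8 * r ^+ 3 * X <= r ^+ 3 * X * (8 + 8 * X + 20 * X ^+ 2).
  have r3 : 0 <= r ^+ 3 * X ^+ 2 * (8 + 20 * X).
    by apply: mulr_ge0; [rewrite mulr_ge0 ?sqr_ge0 ?exprn_ge0 //|]; lra.
  by move: r3; clear; lra.
have m4 : r ^+ 4 * X <= r ^+ 4 * X * (1 + X + X ^+ 2).
  have r4 : 0 <= r ^+ 4 * X ^+ 2 * (1 + X).
    by apply: mulr_ge0; [rewrite mulr_ge0 ?sqr_ge0 ?exprn_ge0 //|]; lra.
  by move: r4; clear; lra.
have mono y : 0 <= y -> y <= X ->
    y * (60 - 192 * y + 288 * y ^+ 2) <= X * (60 - 192 * X + 288 * X ^+ 2).
  move=> y0 yX.
  have : 0 <= (X - y) * (60 - 192 * (X + y) + 288 * (X ^+ 2 + X * y + y ^+ 2)).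
    apply: mulr_ge0; first lra.
    have := sqr_ge0 (X + y - 4 / 9); have := sqr_ge0 (X - y); clear; lra.
  by clear; lra.
have [X8|X8] := lerP (1 / 8) X.
  have := mono (1 / 8) ltac:(lra) X8 => m1.
  have p1 : 81 / 16 <= r * (X * (60 - 192 * X + 288 * X ^+ 2)) by clear -m1 r1; nra.
  have p2 : 1 <= r ^+ 2 by clear -r1; nra.
  have p3 : 1 <= r ^+ 3 by rewrite exprn_ege1.
  have p4 : 1 <= r ^+ 4 by rewrite exprn_ege1.
  have prod (y z d : R) : 1 <= y -> 0 < d -> d <= z -> 1 / 8 * d <= y * (X * z).
    move=> y1 d0 dz; clear -y1 d0 dz X8.
    rewrite -[_ * d]mul1r ler_pM //; try lra.
    by rewrite ler_pM //; lra.
  have n2 : 1 / 8 * (345 / 16) <= r ^+ 2 * (X * (22 - 20 * X + 132 * X ^+ 2)).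
    by apply: prod; [exact: p2 | clear; lra | clear -X8; nra].
  have n3 : 1 / 8 * (149 / 16) <= r ^+ 3 * (X * (8 + 8 * X + 20 * X ^+ 2)).
    by apply: prod; [exact: p3 | clear; lra | clear -X8; nra].
  have n4 : 1 / 8 * 1 <= r ^+ 4 * (X * 1) by clear -p4 prod; apply: prod; [exact: p4 | lra..].
  by rewrite /margin1; move: p1 n2 n3 m4 n4; clear; lra.
suff : 0 <= -9 + r * (X * (60 - 192 * X + 288 * X ^+ 2)) + 212 / 10 * r ^+ 2 * X
    + 8 * r ^+ 3 * X + r ^+ 4 * X.
  by rewrite /margin1; move: m2 m3 m4; clear; lra.
have r65 : 6 / 5 <= r by case: cond => //; lra.
have p2 : 36 / 25 <= r ^+ 2 by clear -r65; nra.
have p3 : 216 / 125 <= r ^+ 3 by clear -r65 p2; rewrite exprS; nra.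
have p4 : 1296 / 625 <= r ^+ 4 by clear -r65 p3; rewrite exprS; nra.
have [X10|X10] := lerP (1 / 10) X.
  have := mono (1 / 10) ltac:(lra) X10 => m1.
  have p1 : 6 / 5 * (4368 / 1000) <= r * (X * (60 - 192 * X + 288 * X ^+ 2)).
    by clear -m1 r65; nra.
  by clear -p1 p2 p3 p4 X10; nra.
have p1 : 204 / 5 * (r * X) <= r * (X * (60 - 192 * X + 288 * X ^+ 2)).
  clear -r1 X0 X10; have rX : 0 <= r * X by apply: mulr_ge0; lra.
  have := mulr_ge0 rX (_ : 0 <= 192 / 10 - 192 * X); have := mulr_ge0 rX (sqr_ge0 X).
  move=> h1 /(_ ltac:(lra)); move: h1.
  by clear; lra.
have : 0 <= X * (204 / 5 * r + 212 / 10 * r ^+ 2 + 8 * r ^+ 3 + r ^+ 4 - 9 * (r + 2) ^+ 2).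
  by apply: mulr_ge0 (ltW X0) _; clear -r65 p2 p3 p4; nra.
by move: p1 qX; clear; nra.
Qed.

Lemma margin2_ge0 (R : realFieldType) (r X : R) :
  1 <= r -> 0 <= X -> (r + 2) ^+ 2 * X <= 1 -> 6 / 5 <= r \/ X <= 9 / 100 ->
  0 <= margin2 r X.
Proof.
move=> r1 X0 qX cond.
have q0 : 0 < (r + 2) ^+ 2 by rewrite exprn_gt0 //; lra.
have X3 : 0 <= X ^+ 3 by rewrite exprn_ge0.
have X2 : 0 <= X ^+ 2 by rewrite exprn_ge0.
have r0 : 0 <= r by lra.
have p2 := exprn_ge0 2 r0; have p3 := exprn_ge0 3 r0.
suff h : 0 <= 6 * r + r ^+ 2 - (2 * r ^+ 3 + 15 * r ^+ 2 + 36) * X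
      - (192 * r + 20 * r ^+ 2) * X ^+ 2.
  have r3 : 0 <= r ^+ 3 * (8 * X ^+ 2 + 20 * X ^+ 3).
    by apply: mulr_ge0 (exprn_ge0 3 r0) _; lra.
  have r4 : 0 <= r ^+ 4 * (X ^+ 2 + X ^+ 3).
    by apply: mulr_ge0 (exprn_ge0 4 r0) _; lra.
  have r5 : 0 <= (288 * r + 132 * r ^+ 2) * X ^+ 3.
    by apply: mulr_ge0 X3; lra.
  by rewrite /margin2; move: h r3 r4 r5; clear; lra.
have A0 : 0 <= 2 * r ^+ 3 + 15 * r ^+ 2 + 36 by lra.
have C0 : 0 <= 192 * r + 20 * r ^+ 2 by lra.
have [r65|r65] := lerP (6 / 5) r; last first.
  have X9 : X <= 9 / 100 by case: cond => //; lra.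
  have := ler_wpM2l A0 X9; have X22 : X ^+ 2 <= (9 / 100) ^+ 2.
    by rewrite ler_pXn2r ?nnegrE //; lra.
  have := ler_wpM2l C0 X22; clear -r1 r65.
  have : r ^+ 3 <= 6 / 5 * r ^+ 2 by rewrite exprS ler_wpM2r ?sqr_ge0 //; lra.
  by nra.
rewrite -(pmulr_rge0 _ (_ : 0 < (r + 2) ^+ 4)); last by rewrite exprn_gt0 //; lra.
have h1 := ler_wpM2l (mulr_ge0 A0 (ltW q0)) qX.
have h2 : ((r + 2) ^+ 2 * X) ^+ 2 <= 1 by rewrite exprn_ile1 // mulr_ge0 // ltW.
have {}h2 := ler_wpM2l C0 h2.
have key : (2 * r ^+ 3 + 15 * r ^+ 2 + 36) * (r + 2) ^+ 2 + (192 * r + 20 * r ^+ 2)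
    <= (6 * r + r ^+ 2) * (r + 2) ^+ 4.
  clear -r65; rewrite -subr_ge0.
  pose s := (r + 2) ^+ 2.
  have -> : (6 * r + r ^+ 2) * (r + 2) ^+ 4
      - ((2 * r ^+ 3 + 15 * r ^+ 2 + 36) * (r + 2) ^+ 2 + (192 * r + 20 * r ^+ 2))
    = s ^+ 2 * (s - 11) + (36 * r ^+ 3 + 116 * r ^+ 2 - 80 * r - 32).
    by rewrite /s; ring.
  have s10 : 10 <= s by rewrite /s; nra.
  have h1 : 0 <= s ^+ 2 * (s - 11) + 100.
    have -> : s ^+ 2 * (s - 11) + 100 = (s - 10) * (s ^+ 2 - s - 10) by ring.
    by apply: mulr_ge0; [lra | nra].
  have r2 : 36 / 25 <= r ^+ 2 by nra.
  have r3 : 36 / 25 * r <= r ^+ 3 by rewrite exprS; nra.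
  by nra.
by move: h1 h2 key; clear; nra.
Qed.

(** The constant 17/2 is tuned so that the loss in [energy_drop6] compensates
the deficit. *)
Lemma margin1_low (R : realFieldType) (r X : R) :
  1 <= r <= 6 / 5 -> X <= 1 / 8 -> 1 <= (r + 2) ^+ 2 * X ->
  0 <= margin1 r X + 17 / 2 * X.
Proof.
move=> /andP[r1 r2] X2 qX; rewrite /margin1.
have X1 : 39 / 400 <= X by clear X2; nra.
have t1 : 28 * X + 155 / 100 <= X * (60 - 192 * X + 288 * X ^+ 2).
  (* The cubic is concave on the range, hence above a chord. *)
  have : 0 <= (X - 39 / 400) * (1 / 8 - X) * (91 - 288 * X).
    by clear -X1 X2; apply: mulr_ge0; [apply: mulr_ge0|]; lra.
  clear -X1 X2; nra.
have X0 : 0 < X by lra.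
have t2 : 85 / 4 * X <= X * (22 - 20 * X + 132 * X ^+ 2).
  rewrite mulrC ler_wpM2l ?ltW //; have := sqr_ge0 (X - 39 / 400).
  by clear -X1; lra.
have sq : 39 / 400 * X <= X ^+ 2 by clear -X1; nra.
have t3 : 888 / 100 * X <= X * (8 + 8 * X + 20 * X ^+ 2).
  by rewrite mulrC ler_wpM2l ?ltW //; clear -X1 sq; lra.
have t4 : 109 / 100 * X <= X * (1 + X + X ^+ 2).
  by rewrite mulrC ler_wpM2l ?ltW //; clear -X1 sq; lra.
have r0 : 0 <= r by lra.
have {}t1 := ler_wpM2l r0 t1.
have {}t2 := ler_wpM2l (sqr_ge0 r) t2.
have {}t3 := ler_wpM2l (exprn_ge0 3 r0) t3.
have {}t4 := ler_wpM2l (exprn_ge0 4 r0) t4.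
suff : 0 <= - 9 + 155 / 100 * r + X * (17 / 2 + 28 * r + 85 / 4 * r ^+ 2 +
    888 / 100 * r ^+ 3 + 109 / 100 * r ^+ 4).
  by move: t1 t2 t3 t4; clear; lra.
have key : (9 - 155 / 100 * r) * (r + 2) ^+ 2 <= 17 / 2 + 28 * r + 85 / 4 * r ^+ 2 +
    888 / 100 * r ^+ 3 + 109 / 100 * r ^+ 4.
  clear -r1.
  have r3 : 1 <= r ^+ 2 by rewrite exprn_ege1.
  have r4 : r <= r ^+ 3 by rewrite exprS ler_peMr //; lra.
  have r5 : r ^+ 2 <= r ^+ 4 by rewrite (_ : 4%N = (2 + 2)%N) // exprD ler_peMr // sqr_ge0.
  by nra.
have := ler_wpM2l (ltW X0) key; have : 0 <= 9 - 155 / 100 * r by lra.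
by move: qX; clear; nra.
Qed.

Lemma margin2_low (R : realFieldType) (r X : R) :
  1 <= r <= 6 / 5 -> 0 <= X -> (r + 2) ^+ 2 * X <= 1 ->
  0 <= margin2 r X + 17 / 2 * X.
Proof.
move=> /andP[r1 r2] X0 qX; rewrite /margin2.
pose K := 288 * r + 132 * r ^+ 2 + 20 * r ^+ 3 + r ^+ 4.
pose A := 2 * r ^+ 3 + 15 * r ^+ 2 + 13 / 2 * r + 51 / 2.
pose C := 104 * r + 20 * r ^+ 2 - 8 * r ^+ 3 - r ^+ 4.
have [b b0 rb] : exists2 b, 0 <= b & r = 1 + b by exists (r - 1); lra.
have b1 : b <= 1 / 5 by lra.
have b2 : b ^+ 2 <= b / 5 by clear -b0 b1; nra.
have p2 : 0 <= b ^+ 2 by exact: exprn_ge0.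
have p3 : 0 <= b ^+ 3 by exact: exprn_ge0.
have p4 : 0 <= b ^+ 4 by exact: exprn_ge0.
have b3 : b ^+ 3 <= b / 25 by clear -b0 b1 b2; rewrite exprS; nra.
have b4 : b ^+ 4 <= b / 125 by clear -b0 b1 b3; rewrite exprS; nra.
have K0 : 0 <= K by rewrite /K rb; lra.
have A0 : 0 <= A by rewrite /A rb; lra.
have C0 : 0 <= C by rewrite /C rb; lra.
(* Bounds X^3 below by a quadratic that touches it at 1/10, close to the
   critical X = 1/9. *)
have t : 0 <= K * (X * (X - 1 / 10) ^+ 2).
  by rewrite mulr_ge0 // mulr_ge0 // sqr_ge0.
have t1 : 0 <= (K / 5 - 88 * r) * X ^+ 2.
  by rewrite mulr_ge0 ?sqr_ge0 // /K rb; lra.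
have t2 : 0 <= (13 / 2 * r - 2 - K / 100) * X.
  by rewrite mulr_ge0 // /K rb; lra.
suff : 0 <= 6 * r + r ^+ 2 - A * X - C * X ^+ 2.
  by move: t t1 t2; rewrite /A /C /K; clear; lra.
have q0 : 0 < (r + 2) ^+ 2 by rewrite exprn_gt0 //; lra.
rewrite -(pmulr_rge0 _ (exprn_gt0 2 q0)).
have h1 := ler_wpM2l (mulr_ge0 A0 (ltW q0)) qX.
have h2 : ((r + 2) ^+ 2 * X) ^+ 2 <= 1 by rewrite exprn_ile1 // mulr_ge0 // ltW.
have {}h2 := ler_wpM2l C0 h2.
have key : A * (r + 2) ^+ 2 + C <= (6 * r + r ^+ 2) * ((r + 2) ^+ 2) ^+ 2.
  rewrite -subr_ge0 /A /C rb; clear -b0.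
  rewrite [X in 0 <= X](_ : _ = 11 + 1223 / 2 * b + 840 * b ^+ 2
    + 899 / 2 * b ^+ 3 + 125 * b ^+ 4 + 18 * b ^+ 5 + b ^+ 6); last by field.
  have c2 := exprn_ge0 2 b0; have c3 := exprn_ge0 3 b0.
  have c4 := exprn_ge0 4 b0; have c5 := exprn_ge0 5 b0; have c6 := exprn_ge0 6 b0.
  by lra.
by move: h1 h2 key; clear; nra.
Qed.

(** The energy at index 6 absorbs a slightly negative margin at index 4. *)
Lemma energy6_below (R : realFieldType) (r x c g : R) (u : nat -> R) :
  1 <= r <= 6 / 5 -> gegenbauer_seq r x u -> 9 / 100 <= x ^+ 2 <= 1 / 8 ->
  (1 - x ^+ 2) * c ^+ 2 - energy x u 4
    = (1 - x ^+ 2) ^+ 2 * g / ((r + 1) * (r + 3)) ^+ 2 ->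
  0 <= g + 17 / 2 * x ^+ 2 ->
  energy x u 6 <= (1 - x ^+ 2) * c ^+ 2.
Proof.
move=> r12 hu X12 id g0; have drop := energy_drop6 r12 hu X12.
have /andP[r1 r2] := r12; have /andP[X1 X2] := X12.
apply: le_trans drop _; rewrite lerBlDr -lerBlDl.
have -> : energy x u 4 - (1 - x ^+ 2) * c ^+ 2
  = - ((1 - x ^+ 2) ^+ 2 * g) / ((r + 1) * (r + 3)) ^+ 2.
  by rewrite mulNr -id opprB.
rewrite ler_pM2r; last by rewrite invr_gt0 exprn_gt0 // mulr_gt0 //; lra.
move: X1 X2 g0; set X := x ^+ 2; clear => X1 X2 g0.
have := ler_wpM2l (sqr_ge0 (1 - X)) g0.
have : (1 - X) ^+ 2 <= (91 / 100) ^+ 2 by rewrite ler_pXn2r ?nnegrE //; lra.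
have X0 : 0 <= X by lra.
by move=> /(ler_wpM2r X0); lra.
Qed.

(** The condition u 1 <= u 2 means (r + 2) x <= -1. *)
Lemma first_min_one (R : realFieldType) (r x : R) (u : nat -> R) :
  1 <= r -> -1 < x < 1 -> gegenbauer_seq r x u -> u 1%N < 0 -> u 1%N <= u 2%N ->
  forall n, u 1%N <= u n.
Proof.
move=> r1 x11 hu uneg up.
have /andP[x1 x2] := x11; have s0 := sqr_sin_gt0 x11.
have u0 : u 0%N = 1 by case: hu.
have u1 : u 1%N = x by case: hu.
have mono n : (n < 1)%N -> u n.+1 <= u n.
  by case: n => // _; rewrite u0 u1 ltW.
have x0 : x < 0 by rewrite -u1.
have xr : (r + 2) * x <= -1.
  move: up; rewrite u1 (u2E r1 hu) ler_pdivlMr; last lra.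
  by clear -x2; nra.
have qX : 1 <= (r + 2) ^+ 2 * x ^+ 2 by rewrite -exprMn; clear -xr; nra.
have X1 : x ^+ 2 <= 1 by lra.
have D0 : 0 < (r + 1) * (r + 3) by apply: mulr_gt0; lra.
have up3 : u 1%N <= u 3%N.
  rewrite u1 (u3E r1 hu) ler_pdivlMr; last lra.
  have : 0 <= (r + 4) * (- x) * (1 - x ^+ 2) by rewrite !mulr_ge0 //; lra.
  by clear; nra.
have [r65|r65] := lerP (6 / 5) r.
  apply: (@energy_trap _ r x u 1 4 r1 x11 hu uneg mono).
    by move=> [|[|[|[|n]]]].
  rewrite -subr_ge0 (energy4_margin1 r1 hu) divr_ge0 ?sqr_ge0 // mulr_ge0 ?sqr_ge0 //.
  by apply: margin1_ge0 => //; left.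
have [X8|X8] := lerP (1 / 8) (x ^+ 2).
  apply: (@energy_trap _ r x u 1 4 r1 x11 hu uneg mono).
    by move=> [|[|[|[|n]]]].
  rewrite -subr_ge0 (energy4_margin1 r1 hu) divr_ge0 ?sqr_ge0 // mulr_ge0 ?sqr_ge0 //.
  by apply: margin1_ge0 => //; right.
have X9 : 9 / 100 <= x ^+ 2.
  have : (r + 2) ^+ 2 <= (16 / 5) ^+ 2 by rewrite ler_pXn2r ?nnegrE //; lra.
  by move=> /(ler_wpM2r (sqr_ge0 x)); move: qX; clear; lra.
have x3 : x <= - (3 / 10) by clear -X9 x0; nra.
have r12 : 1 <= r <= 6 / 5 by rewrite r1 ltW.
apply: (@energy_trap _ r x u 1 6 r1 x11 hu uneg mono).
  move=> [|[|[|[|[|[|n]]]]]] // _; rewrite u1.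
    rewrite (u4E r1 hu) ler_pdivlMr //.
    have : x * ((r + 1) * (r + 3)) <= - (3 / 10) * 8.
      rewrite -[_ * 8]mulrC -[x * _]mulrC; clear -x3 r1; nra.
    have -> : x ^+ 4 = (x ^+ 2) ^+ 2 by rewrite -exprM.
    by move: X9 X8; set X := x ^+ 2; clear -r1 r65; nra.
  rewrite (u5E r1 hu) ler_pdivlMr // -subr_ge0.
  have -> : x * ((r + 6) * (r + 8) * x ^+ 4 - 10 * (r + 6) * x ^+ 2 + 15)
      - x * ((r + 1) * (r + 3))
    = - x * ((1 - x ^+ 2) * (r + 6) * ((r + 8) * x ^+ 2 - (2 - r))) by ring.
  rewrite mulr_ge0 ?mulr_ge0 //; try lra.
  have h1 : 0 <= (r + 8) * ((r + 2) ^+ 2 * x ^+ 2 - 1) by rewrite mulr_ge0 //; lra.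
  have h2 : 0 <= (r - 1) * (r + 3) * r by rewrite !mulr_ge0 //; lra.
  have q0 : 0 < (r + 2) ^+ 2 by rewrite exprn_gt0 //; lra.
  by rewrite -(pmulr_rge0 _ q0); clear -h1 h2; lra.
apply: (energy6_below r12 hu _ (energy4_margin1 r1 hu)).
  by rewrite X9 ltW.
by apply: margin1_low => //; exact: ltW.
Qed.

(** Here (r + 2) x >= -1, and the two-step criterion works from x = 1/7 on, or
for all x >= 0 when r >= 3.  Below that (r + 2)^2 x^2 <= 1 and the margins are
used. *)
Lemma first_min_two (R : realFieldType) (r x : R) (u : nat -> R) :
  1 <= r -> -1 < x < 1 -> gegenbauer_seq r x u -> u 2%N <= u 1%N ->
  u 2%N < 0 -> u 2%N <= u 3%N -> forall n, u 2%N <= u n.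
Proof.
move=> r1 x11 hu dec uneg up.
have /andP[x1 x2] := x11; have s0 := sqr_sin_gt0 x11.
have u0 : u 0%N = 1 by case: hu.
have u1 : u 1%N = x by case: hu.
have mono n : (n < 2)%N -> u n.+1 <= u n.
  by case: n => [|[|n]] // _; rewrite u0 u1 ltW.
have xr : -1 <= (r + 2) * x.
  move: dec; rewrite u1 (u2E r1 hu) ler_pdivrMr; last lra.
  by clear -x2; nra.
have D0 : 0 < (r + 1) * (r + 3) by apply: mulr_gt0; lra.
have crit_case : 0 <= x ->
    (3 / (3 + r)) ^+ 2 <= (1 - (4 / (4 + r)) ^+ 2) * (1 + x + 3 / (3 + r) * x) ^+ 2 ->
    forall n, u 2%N <= u n.
  move=> x0 crit; apply: (@min_of_criterion _ r x u 1) => //; first by rewrite x0.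
  have -> : 2 + 1 = 3 :> R by ring.
  by have -> : 2 + 2 = 4 :> R by ring.
have [x7|x7] := lerP (1 / 7) x.
  apply: crit_case; first lra.
  have -> : 1 - (4 / (4 + r)) ^+ 2 = r * (8 + r) / (4 + r) ^+ 2.
    by field; rewrite gt_eqF //; lra.
  have -> : 1 + x + 3 / (3 + r) * x = (3 + r + x * (6 + r)) / (3 + r).
    by field; rewrite gt_eqF //; lra.
  rewrite !expr_div_n mulrA ler_pM2r ?invr_gt0 ?exprn_gt0 //; last lra.
  rewrite mulrAC ler_pdivlMr ?exprn_gt0 //; last lra.
  have h1 : (27 / 7 + 8 / 7 * r) ^+ 2 <= (3 + r + x * (6 + r)) ^+ 2.
    by rewrite ler_pXn2r ?nnegrE //; clear -x7 r1; nra.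
  have h2 : 3 ^+ 2 * (4 + r) ^+ 2 <= r * (8 + r) * (27 / 7 + 8 / 7 * r) ^+ 2.
    have h3 : (4 + r) ^+ 2 <= (27 / 7 + 8 / 7 * r) ^+ 2.
      by rewrite ler_pXn2r ?nnegrE //; lra.
    by apply: ler_pM h3; rewrite ?sqr_ge0 //; clear -r1; nra.
  by apply: le_trans h2 _; apply: ler_wpM2l h1; apply: mulr_ge0; lra.
have [/andP[x0 r3]|far] := boolP ((0 <= x) && (3 <= r)).
  apply: crit_case => //; apply: (@criterion_mono _ _ 0 _ _ (7 / 10)); try lra.
  - by rewrite divr_gt0 //; lra.
  - by rewrite ler_pdivrMr ?[_ / _ * _]mulrAC ?ler_pdivlMr; lra.
  - by rewrite ler_pdivrMr; lra.
have qX : (r + 2) ^+ 2 * x ^+ 2 <= 1.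
  rewrite -exprMn; have [x0|x0] := lerP 0 x.
    have r3 : r < 3 by rewrite ltNge; move: far; rewrite x0.
    by rewrite expr_le1 // ?mulr_ge0 //; clear -x0 x7 r1 r3; nra.
  have yle0 : (r + 2) * x <= 0 by rewrite pmulr_rle0; lra.
  by move: xr yle0; set y := _ * x; clear; nra.
have by4 : 6 / 5 <= r \/ x ^+ 2 <= 9 / 100 -> forall n, u 2%N <= u n.
  move=> cond; apply: (@energy_trap _ r x u 2 4 r1 x11 hu uneg mono).
    by move=> [|[|[|[|n]]]].
  rewrite -subr_ge0 (energy4_margin2 r1 hu) divr_ge0 ?sqr_ge0 // mulr_ge0 ?sqr_ge0 //.
  by apply: margin2_ge0 => //; exact: sqr_ge0.
have [r65|r65] := lerP (6 / 5) r; first by apply: by4; left.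
have [X9|X9] := lerP (x ^+ 2) (9 / 100); first by apply: by4; right.
have x3 : x <= - (3 / 10) by clear -X9 x7; nra.
have r12 : 1 <= r <= 6 / 5 by rewrite r1 ltW.
have X8 : x ^+ 2 <= 1 / 8 by clear -qX r1; nra.
apply: (@energy_trap _ r x u 2 6 r1 x11 hu uneg mono).
  move=> [|[|[|[|[|[|n]]]]]] // _.
    rewrite -subr_ge0 (u4E r1 hu) (u2E r1 hu).
    have -> : ((r + 4) * (r + 6) * x ^+ 4 - 6 * (r + 4) * x ^+ 2 + 3) / ((r + 1) * (r + 3))
        - ((r + 2) * x ^+ 2 - 1) / (r + 1)
      = ((r + 4) * (r + 6) * (x ^+ 2) ^+ 2 + (6 + r - x ^+ 2 * (r ^+ 2 + 11 * r + 30)))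
        / ((r + 1) * (r + 3)).
      by field; rewrite !gt_eqF //=; lra.
    apply: divr_ge0; last exact: ltW.
    apply: addr_ge0; last by clear -X8 r1 r65; nra.
    by apply: mulr_ge0 (sqr_ge0 _); apply: mulr_ge0; lra.
  rewrite -subr_ge0 (u5E r1 hu) (u2E r1 hu).
  have -> : x * ((r + 6) * (r + 8) * x ^+ 4 - 10 * (r + 6) * x ^+ 2 + 15) / ((r + 1) * (r + 3))
      - ((r + 2) * x ^+ 2 - 1) / (r + 1)
    = (1 - x) * ((r + 3) * (1 + (r + 2) * x)
        - (- x) * (1 + x) * (r + 6) * (2 - r - (r + 8) * x ^+ 2)) / ((r + 1) * (r + 3)).
    by field; rewrite !gt_eqF //=; lra.
  apply: divr_ge0; last exact: ltW.
  apply: mulr_ge0; first lra.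
  pose dl := 1 + (r + 2) * x.
  have d0 : 0 <= dl by rewrite /dl; lra.
  (* dl vanishes exactly when u 1 = u 2; for r = 1 both sides do. *)
  have h1 : 2 - r - (r + 8) * x ^+ 2 <= 2 * dl.
    have q0 : 0 < (r + 2) ^+ 2 by rewrite exprn_gt0 //; lra.
    have p1 : 0 <= (r - 1) * (r + 3) * r by clear -r1; rewrite !mulr_ge0 //; lra.
    have p2 : 0 <= dl * ((r - 1) * (r + 4)) by clear -r1 d0; rewrite !mulr_ge0 //; lra.
    have p3 : 0 <= (r + 8) * dl ^+ 2 by rewrite mulr_ge0 ?sqr_ge0 //; lra.
    rewrite -(ler_pM2l q0); move: p1 p2 p3; rewrite /dl; clear; lra.
  have h2 : 0 <= - x * (1 + x) <= 1 / 4.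
    have sq := sqr_ge0 (x + 1 / 2).
    by apply/andP; split; [apply: mulr_ge0|]; clear -x3 x1 sq; lra.
  rewrite subr_ge0 -/dl.
  have /andP[h3 h4] := h2.
  have h5 : 0 <= (- x) * (1 + x) * (r + 6) by rewrite mulr_ge0 //; lra.
  apply: le_trans (ler_wpM2l h5 h1) _.
  have h6 : - x * (1 + x) * (r + 6) * 2 <= r + 3 by clear -h4 h3 r1; nra.
  by rewrite mulrA ler_wpM2r.
apply: (energy6_below r12 hu _ (energy4_margin2 r1 hu)).
  by rewrite X8 andbT ltW.
by apply: margin2_low => //; exact: sqr_ge0.
Qed.

(** At the end of a descent u is negative: the recurrence writes
u (j+1) - u j as a multiple of u j - u (j-1) minus a positive multiple of u j. *)
Lemma first_descent_end_is_min (R : realFieldType) (r x : R) (u : nat -> R) (j : nat) :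
  1 <= r -> -1 < x < 1 -> gegenbauer_seq r x u ->
  (forall n, (n < j)%N -> u n.+1 <= u n) -> u j < u j.+1 ->
  forall n, u j <= u n.
Proof.
move=> r1 x11 hu mono up; have /andP[x1 x2] := x11.
case: j mono up => [|j] mono up.
  by case: hu up => -> -> _; rewrite ltNge ltW.
have uneg : u j.+1 < 0.
  have e := gegenbauer_next j r1 hu; have dec := mono j (ltnSn j).
  have k0 : 0 <= j.+1%:R / (j.+1%:R + r).
    by rewrite divr_ge0 //; have := ler0n R j.+1; lra.
  rewrite ltNge; apply/negP => upos.
  have p1 : 0 <= (1 - x) * u j.+1 by apply: mulr_ge0 => //; lra.
  have p2 : 0 <= j.+1%:R / (j.+1%:R + r) * (u j - u j.+1 + (1 - x) * u j.+1).
    by apply: mulr_ge0 => //; lra.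
  by move: up; rewrite e ltNge; apply/negP/negPn; move: p1 p2; clear; lra.
have up' := ltW up.
case: j mono uneg up' {up} => [|[|j]] mono uneg up.
- exact: (first_min_one r1 x11 hu uneg up).
- exact: (first_min_two r1 x11 hu (mono 1%N isT) uneg up).
have [jr|jr] := lerP j.+3%:R (12 * r).
  exact: (@first_min_moderate _ r x u j.+3).
exact: (first_min_large r1 x11 hu (ltW jr) mono uneg up).
Qed.

(** * The ultraspherical scalar product *)

Lemma powR_cvg_right0 (R : realType) (a : R) : 0 <= a ->
  (y `^ a @[y --> 0^'+] --> (0 : R) `^ a)%classic.
Proof.
rewrite le_eqVlt => /predU1P[<-|a0].
  by under eq_fun do rewrite powRr0; rewrite powRr0; exact: cvg_cst.
by rewrite powR0 ?gt_eqF //; exact: powR_cvg0.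
Qed.

Lemma jacobi_weightN (R : realType) (a t : R) :
  jacobi_weight a a (- t) = jacobi_weight a a t.
Proof. by rewrite /jacobi_weight opprK mulrC. Qed.

Lemma is_derive_jacobi_weight (R : realType) (a t : R) : -1 < t < 1 ->
  is_derive t 1 (jacobi_weight a a)
    (- (2 * a * t) / (1 - t ^+ 2) * jacobi_weight a a t).
Proof.
move=> /andP[t1 t2].
have p1 : 0 < 1 - t by lra.
have p2 : 0 < 1 + t by lra.
(* Each factor by the chain rule; 0 - 1 and 0 + 1 are the inner derivatives. *)
have d1 : is_derive t 1 (fun t : R => (1 - t) `^ a) (a * (1 - t) `^ (a - 1) * (0 - 1)).
  apply: (@is_derive1_comp R (fun y => y `^ a) (fun t => 1 - t)).
  exact: is_derive1_powR.
have d2 : is_derive t 1 (fun t : R => (1 + t) `^ a) (a * (1 + t) `^ (a - 1) * (0 + 1)).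
  apply: (@is_derive1_comp R (fun y => y `^ a) (fun t => 1 + t)).
  exact: is_derive1_powR.
have d := @is_deriveM R R _ _ _ _ _ _ d1 d2.
apply: (@trigger_derive R _ t _ _ d).
have powB1 (y : R) : 0 < y -> y `^ (a - 1) = y `^ a / y.
  by move=> y0; rewrite powRB ?powRr1 ?(ltW y0) // (gt_eqF y0) implybT.
rewrite /jacobi_weight !powB1 // /GRing.scale /=.
have -> : 1 - t ^+ 2 = (1 - t) * (1 + t) by ring.
by field; rewrite !gt_eqF //; lra.
Qed.

(** At an end point one factor is a power of a variable tending to 0 from the
right, which converges because the exponent is nonnegative. *)
Lemma jacobi_weight_continuous (R : realType) (a : R) : 0 <= a ->
  {within `[(-1 : R), 1], continuous (jacobi_weight a a)}%classic.
Proof.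
move=> a0.
have left : (jacobi_weight a a t @[t --> (-1)^'+] --> jacobi_weight a a (-1 : R))%classic.
  apply: cvgM.
    apply: cvg_at_right_filter.
    have : is_derive (-1 : R) 1 (fun t : R => (1 - t) `^ a) (a * (1 - -1) `^ (a - 1) * (0 - 1)).
      apply: (@is_derive1_comp R (fun y => y `^ a) (fun t => 1 - t)).
      by apply: is_derive1_powR; lra.
    by move=> [+ _] => /derivable1_diffP /differentiable_continuous.
  rewrite addrN; apply: cvg_comp (powR_cvg_right0 a0).
  move=> A [e /= e0 eA]; exists e => //= t te tgt; apply: eA => /=; last lra.
  by have -> : 0 - (1 + t) = -1 - t by ring.
apply/continuous_within_itvP; first by lra.
split=> //.
  move=> t; rewrite in_itv /= => tin.
  have [+ _] := is_derive_jacobi_weight a tin.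
  by move=> /derivable1_diffP /differentiable_continuous.
rewrite -(opprK (1 : R)) jacobi_weightN.
apply/cvg_at_leftNP; rewrite opprK.
rewrite (_ : _ \o _ = jacobi_weight a a) //; apply/funext => t.
exact: jacobi_weightN.
Qed.

Lemma jacobi_integrable (R : realType) (a : R) (p : {poly R}) : 0 <= a ->
  (@lebesgue_measure R).-integrable `[(-1 : R), 1]%classic
     (EFin \o (fun t => p.[t] * jacobi_weight a a t)).
Proof.
move=> a0; apply: continuous_compact_integrable; first exact: segment_compact.
apply/subspace_continuousP => t tin; apply: cvgM.
  by apply: cvg_within_filter; exact: continuous_horner.
by have /subspace_continuousP := jacobi_weight_continuous a0; exact.
Qed.

Lemma jacobi_dotE (R : realType) (a b : R) (p q : {poly R}) :
  jacobi_dot a b p q = (\int[@lebesgue_measure R]_(t in `[(-1 : R), 1]%classic)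
    ((p * q).[t] * jacobi_weight a b t))%R.
Proof. by apply: eq_Rintegral => t _; rewrite hornerM. Qed.

Lemma jacobi_dotC (R : realType) (a b : R) (p q : {poly R}) :
  jacobi_dot a b p q = jacobi_dot a b q p.
Proof. by rewrite !jacobi_dotE mulrC. Qed.

Lemma jacobi_dotDl (R : realType) (a : R) (p1 p2 q : {poly R}) : 0 <= a ->
  jacobi_dot a a (p1 + p2) q = jacobi_dot a a p1 q + jacobi_dot a a p2 q.
Proof.
move=> a0; rewrite !jacobi_dotE -RintegralD //; try exact: jacobi_integrable.
by apply: eq_Rintegral => t _; rewrite mulrDl hornerD mulrDl.
Qed.

Lemma jacobi_dotZl (R : realType) (a c : R) (p q : {poly R}) : 0 <= a ->
  jacobi_dot a a (c *: p) q = c * jacobi_dot a a p q.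
Proof.
move=> a0; rewrite !jacobi_dotE -RintegralZl //; try exact: jacobi_integrable.
by apply: eq_Rintegral => t _; rewrite -scalerAl hornerZ -mulrA.
Qed.

(** The ultraspherical differential operator, r = 2 alpha + 1. *)
Definition gegenbauer_op (R : realType) (r : R) (p : {poly R}) : {poly R} :=
  (1 - 'X ^+ 2) * p^`()^`() - (r + 1) *: ('X * p^`()).

(** Lagrange's identity: (L p * q - p * L q) w is the derivative of
(1 - t^2) (p' q - p q') w, which vanishes at both end points. *)
Lemma gegenbauer_op_sym (R : realType) (a : R) (p q : {poly R}) : 0 <= a ->
  jacobi_dot a a (gegenbauer_op (2 * a + 1) p) q
  = jacobi_dot a a p (gegenbauer_op (2 * a + 1) q).
Proof.
move=> a0; apply/eqP; rewrite -subr_eq0; apply/eqP.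
set L := gegenbauer_op _.
pose W := p^`() * q - p * q^`().
pose F t := ((1 - 'X ^+ 2) * W).[t] * jacobi_weight a a t.
pose f t := (L p * q - p * L q).[t] * jacobi_weight a a t.
have -> : jacobi_dot a a (L p) q - jacobi_dot a a p (L q)
    = (\int[@lebesgue_measure R]_(t in `[(-1 : R), 1]%classic) (f t))%R.
  rewrite !jacobi_dotE -RintegralB //; try exact: jacobi_integrable.
  apply: eq_Rintegral => t _; by rewrite /f -mulrBl -hornerN -hornerD.
have cwithin (s : {poly R}) :
  {within `[(-1 : R), 1], continuous (fun t => s.[t] * jacobi_weight a a t)}%classic.
  apply/subspace_continuousP => t tin; apply: cvgM.
    by apply: cvg_within_filter; exact: continuous_horner.
  by have /subspace_continuousP := jacobi_weight_continuous a0; exact.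
have N11 : -1 < 1 :> R by lra.
have dF (t : R) : -1 < t < 1 -> is_derive t 1 F (f t).
  move=> t11; have dw := is_derive_jacobi_weight a t11.
  have d := @is_deriveM R R _ _ _ _ _ _ (is_derive_poly ((1 - 'X ^+ 2) * W) t) dw.
  apply: (@trigger_derive R _ t _ _ d).
  rewrite /f /L /gegenbauer_op /W /GRing.scale /=.
  rewrite /jacobi_weight !poly.derivE !hornerE /=.
  move: t11 => /andP[t1 t2].
  field; rewrite gt_eqF //; nra.
rewrite /Rintegral (@continuous_FTC2 _ f F _ _ N11).
- by rewrite /F !hornerE /= ; ring.
- exact: cwithin.
- have /(continuous_within_itvP _ N11) [_ h1 h2] := cwithin ((1 - 'X ^+ 2) * W).
  split=> // t; rewrite in_itv /= => tin.
  by have [] := dF t tin.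
- move=> t; rewrite in_itv /= => tin.
  by rewrite derive1E; have [_ ->] := dF t tin.
Qed.

Lemma exists_nonroot (R : realType) (p : {poly R}) : p != 0 ->
  exists2 c : R, 0 < c <= 1 / 2 & p.[c] != 0.
Proof.
move=> p0; pose s := [seq (n.+2%:R : R)^-1 | n <- iota 0 (size p)].
have us : uniq s.
  rewrite map_inj_uniq ?iota_uniq // => m n /invr_inj /eqP.
  by rewrite eqr_nat => /eqP [].
have [allr|] := boolP (all (root p) s).
  by have := max_poly_roots p0 allr us; rewrite size_map size_iota ltnn.
rewrite -has_predC => /hasP[c /mapP[n _ ->] /= h].
exists n.+2%:R^-1; last by move: h; rewrite rootE.
rewrite invr_gt0 ltr0Sn /= mul1r lef_pV2 ?posrE //.
by rewrite ler_nat.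
Qed.

(** A nonzero polynomial has a nonroot inside the interval, around which the
integrand is bounded below by a positive constant. *)
Lemma jacobi_dot_gt0 (R : realType) (a : R) (p : {poly R}) : 0 <= a -> p != 0 ->
  0 < jacobi_dot a a p p.
Proof.
move=> a0 p0; have [c /andP[c0 c1] pc] := exists_nonroot p0.
rewrite jacobi_dotE; pose f t := (p * p).[t] * jacobi_weight a a t.
have w0 (t : R) : 0 <= jacobi_weight a a t by rewrite mulr_ge0 ?powR_ge0.
have f0 t : 0 <= f t by rewrite mulr_ge0 // hornerM -expr2 sqr_ge0.
have fc : 0 < f c.
  rewrite mulr_gt0 ?hornerM -?expr2 ?exprn_even_gt0 //.
  by rewrite mulr_gt0 // powR_gt0; lra.
have cf : {for c, continuous f}.
  apply: cvgM; first exact: continuous_horner.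
  have cin : -1 < c < 1 by apply/andP; split; lra.
  have [+ _] := is_derive_jacobi_weight a cin.
  by move=> /derivable1_diffP /differentiable_continuous.
have e0 : 0 < f c / 2 by rewrite divr_gt0.
have /nbhs_ballP [d /= d0 dP] : \forall t \near c, f c / 2 <= f t.
  have := cf; move=> /cvgr_ge; apply; lra.
pose d' := Num.min (d / 2) (1 / 4).
have d'0 : 0 < d' by rewrite lt_min; lra.
have d'd : d' <= d / 2 by rewrite ge_min lexx.
have d'4 : d' <= 1 / 4 by rewrite ge_min lexx orbT.
have fint := jacobi_integrable (p * p) a0.
have sub : (`[c - d', c + d'] `<=` `[-1, 1])%classic.
  by move=> t /=; rewrite !in_itv /= => /andP[t1 t2]; apply/andP; split; lra.
have /integrableP[mf _] := fint.
apply: fine_gt0; apply/andP; split; last first.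
  have : (\int[lebesgue_measure]_(t in `[(-1)%R : R, 1%R]%classic) (f t)%:E)%E \is a fin_num.
    exact: integrable_fin_num fint.
  by rewrite fin_numE ltey => /andP[_].
apply: (@lt_le_trans _ _ ((f c / 2)%:E * lebesgue_measure `[(c - d')%R, (c + d')%R]%classic)%E).
  rewrite lebesgue_measure_itv /= lte_fin ifT; last lra.
  by rewrite -EFinB -EFinM lte_fin mulr_gt0 //; lra.
apply: (@le_trans _ _ (\int[lebesgue_measure]_(t in `[(c - d')%R, (c + d')%R]%classic) (f t)%:E)%E).
  rewrite -integral_cst //; apply: ge0_le_integral => //=.
  - by move=> t _; rewrite lee_fin ltW.
  - exact: measurable_funS mf.
  - move=> t; rewrite in_itv /= => /andP[t1 t2]; rewrite lee_fin; apply: dP.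
    by rewrite /ball /= ltr_norml; apply/andP; split; lra.
by apply: ge0_subset_integral => // t _; rewrite /= lee_fin f0.
Qed.

(** * The differential equation determines the family *)

Lemma coef_gegenbauer_op (R : realType) (r : R) (p : {poly R}) (m : nat) :
  (gegenbauer_op r p)`_m
  = (m.+2 * m.+1)%:R * p`_m.+2 - m%:R * (m%:R + r) * p`_m.
Proof.
rewrite /gegenbauer_op mulrBl mul1r !coefB coefZ coefXnM coefXM.
by case: m => [|[|m]] /=; rewrite ?subn2 /= !coef_deriv; ring.
Qed.

Lemma size_gegenbauer_op (R : realType) (r : R) (p : {poly R}) :
  (size (gegenbauer_op r p) <= size p)%N.
Proof.
apply/leq_sizeP => m pm; rewrite coef_gegenbauer_op !nth_default ?mulr0 ?subr0 //.
by rewrite !leqW.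
Qed.

Lemma gegenbauer_op_linear (R : realType) (r c : R) (p q : {poly R}) :
  gegenbauer_op r (c *: p + q) = c *: gegenbauer_op r p + gegenbauer_op r q.
Proof.
by rewrite /gegenbauer_op !derivD !derivZ -!mul_polyC; ring.
Qed.

(** The leading coefficient determines the eigenvalue, and n (n + r) is injective
in n. *)
Lemma size_eigenpoly (R : realType) (r : R) (n : nat) (p : {poly R}) :
  1 <= r -> p != 0 -> gegenbauer_op r p = - (n%:R * (n%:R + r)) *: p ->
  size p = n.+1.
Proof.
move=> r1 p0 eig; have sp : (0 < size p)%N by rewrite size_poly_gt0.
have := congr1 (fun q : {poly R} => q`_(size p).-1) eig.
rewrite coefZ coef_gegenbauer_op; set m := (size p).-1.
have sm : size p = m.+1 by rewrite prednK.
rewrite (nth_default _ (_ : size p <= m.+2)%N) ?sm // mulr0 sub0r -mulNr.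
have lead0 : p`_m != 0 by rewrite -lead_coefE lead_coef_eq0.
move=> /(mulIf lead0) /oppr_inj eq.
have : (m%:R - n%:R) * (m%:R + n%:R + r) = 0 :> R by rewrite mulrDr; move: eq; lra.
have m0 := ler0n R m; have n0 := ler0n R n.
move=> /eqP; rewrite mulf_eq0 => /orP[|]; last by rewrite gt_eqF //; lra.
by rewrite subr_eq0 eqr_nat => /eqP ->.
Qed.

(** Two consecutive polynomials are carried along, since the recurrence has depth
two. *)
Fixpoint gegenbauer_pair (R : realType) (r : R) (n : nat) : {poly R} * {poly R} :=
  if n is m.+1 then
    let: (p, q) := gegenbauer_pair r m in
    (q, 'X * q + (n%:R / (n%:R + r)) *: ('X * q - p))
  else (1, 'X).

Definition gegenbauer_poly (R : realType) (r : R) (n : nat) : {poly R} :=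
  (gegenbauer_pair r n).1.

Lemma gegenbauer_polySS (R : realType) (r : R) (n : nat) :
  gegenbauer_poly r n.+2 = 'X * gegenbauer_poly r n.+1
   + (n.+1%:R / (n.+1%:R + r)) *: ('X * gegenbauer_poly r n.+1 - gegenbauer_poly r n).
Proof. by rewrite /gegenbauer_poly /=; case: gegenbauer_pair. Qed.

(** The two structure relations imply each other through the recurrence; proving
them together for consecutive indices makes the induction go through. *)
Lemma gegenbauer_poly_deriv (R : realType) (r : R) (n : nat) : 1 <= r ->
  (1 - 'X ^+ 2) * (gegenbauer_poly r n)^`()
    = (n%:R + r%:P) * ('X * gegenbauer_poly r n - gegenbauer_poly r n.+1)
  /\ (1 - 'X ^+ 2) * (gegenbauer_poly r n.+1)^`()
    = n.+1%:R * (gegenbauer_poly r n - 'X * gegenbauer_poly r n.+1).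
Proof.
move=> r1; elim: n => [|n [S T]].
  by rewrite /gegenbauer_poly /= derivX -(polyC1 R) derivC; split; ring.
have kE : (n.+1%:R / (n.+1%:R + r))%:P * (n.+1%:R + r%:P) = n.+1%:R :> {poly R}.
  rewrite -polyC_natr -polyCD -polyCM divfK // gt_eqF //.
  by have := ler0n R n.+1; lra.
have rec := gegenbauer_polySS r n; move: S T kE rec.
rewrite -mul_polyC; set k0 := _ / _.
set g0 := gegenbauer_poly r n; set g1 := gegenbauer_poly r n.+1.
set g2 := gegenbauer_poly r n.+2; set N := n.+1%:R : {poly R}.
move=> S T kE rec.
have dE : g2^`() = (1 + k0%:P) * g1 + (1 + k0%:P) * 'X * g1^`() - k0%:P * g0^`().
  by rewrite rec !poly.derivE; ring.
move: kE rec dE; set k := k0%:P => kE rec dE.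
have nE : n%:R = N - 1 :> {poly R} by rewrite /N -natr1 addrK.
have n2 : n.+2%:R = N + 1 :> {poly R} by rewrite /N natr1.
split.
  rewrite T rec.
  have -> : (N + r%:P) * ('X * g1 - ('X * g1 + k * ('X * g1 - g0)))
    = (k * (N + r%:P)) * (g0 - 'X * g1) by ring.
  by rewrite kE.
rewrite n2 dE rec.
have -> : (1 - 'X ^+ 2) * ((1 + k) * g1 + (1 + k) * 'X * g1^`() - k * g0^`())
  = (1 + k) * (1 - 'X ^+ 2) * g1 + (1 + k) * 'X * ((1 - 'X ^+ 2) * g1^`())
    - k * ((1 - 'X ^+ 2) * g0^`()) by ring.
rewrite T S nE.
have aux (X k' N' a b c : {poly R}) : k' * (N' + c) = N' ->
    (1 + k') * (1 - X ^+ 2) * b + (1 + k') * X * (N' * (a - X * b))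
      - k' * ((N' - 1 + c) * (X * a - b))
    = (N' + 1) * (b - X * (X * b + k' * (X * b - a))).
  move=> h; have e : k' * (N' - 1 + c) = N' - k' by rewrite -[in RHS]h; ring.
  by rewrite [k' * (_ * _)]mulrA e; ring.
exact: aux.
Qed.

(** The structure relations give derivatives only up to the factor 1 - X^2, so the
equation is proved after multiplication by it. *)
Lemma gegenbauer_poly_eigen (R : realType) (r : R) (n : nat) : 1 <= r ->
  gegenbauer_op r (gegenbauer_poly r n)
  = - (n%:R * (n%:R + r)) *: gegenbauer_poly r n.
Proof.
move=> r1; case: n => [|n].
  rewrite mul0r oppr0 scale0r /gegenbauer_op /gegenbauer_poly /=.
  by rewrite -(polyC1 R) !derivC !mulr0 scaler0 subr0.
have [S T] := gegenbauer_poly_deriv n r1.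
have D := congr1 (@deriv R) T.
move: D S T; rewrite /gegenbauer_op -!mul_polyC.
set g0 := gegenbauer_poly r n; set g1 := gegenbauer_poly r n.+1.
have -> : ((1 - 'X ^+ 2) * g1^`())^`() = - (2 * 'X * g1^`()) + (1 - 'X ^+ 2) * g1^`()^`().
  by rewrite !poly.derivE; ring.
have -> : (n.+1%:R * (g0 - 'X * g1))^`() = n.+1%:R * (g0^`() - (g1 + 'X * g1^`())).
  by rewrite !mulr_natl derivMn derivB derivM derivX mul1r.
move=> D S T.
have X0 : (1 - 'X ^+ 2 : {poly R}) != 0.
  apply/eqP => /(congr1 (fun p : {poly R} => p.[0])); rewrite !hornerE /=.
  by move/eqP; rewrite expr0n /= subr0 oner_eq0.
apply: (mulfI X0).
have D' : (1 - 'X ^+ 2) * g1^`()^`() = 2 * 'X * g1^`()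
   + n.+1%:R * (g0^`() - (g1 + 'X * g1^`())).
  by rewrite -D; ring.
have aux (X N c a b da db ddb : {poly R}) :
    (1 - X ^+ 2) * da = (N - 1 + c) * (X * a - b) ->
    (1 - X ^+ 2) * db = N * (a - X * b) ->
    (1 - X ^+ 2) * ddb = 2 * X * db + N * (da - (b + X * db)) ->
    (1 - X ^+ 2) * ((1 - X ^+ 2) * ddb - (c + 1) * (X * db))
    = (1 - X ^+ 2) * (- (N * (N + c)) * b).
  move=> Sa Tb Db.
  transitivity (2 * X * ((1 - X ^+ 2) * db) + N * ((1 - X ^+ 2) * da)
     - N * (1 - X ^+ 2) * b - N * X * ((1 - X ^+ 2) * db)
     - (c + 1) * X * ((1 - X ^+ 2) * db)); first by rewrite Db; ring.
  by rewrite Sa Tb; ring.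
have nE : n%:R = n.+1%:R - 1 :> {poly R} by rewrite -natr1 addrK.
rewrite nE in S.
by rewrite polyCN polyCM !polyCD polyC1 polyC_natr; exact: aux S T D'.
Qed.

Lemma gegenbauer_poly1 (R : realType) (r : R) (n : nat) :
  (gegenbauer_poly r n).[1] = 1.
Proof.
suff [] : (gegenbauer_poly r n).[1] = 1 /\ (gegenbauer_poly r n.+1).[1] = 1 by [].
elim: n => [|n [h1 h2]]; first by rewrite /gegenbauer_poly /= !hornerE.
by split=> //; rewrite gegenbauer_polySS !hornerE h1 h2; ring.
Qed.

Lemma gegenbauer_poly_seq (R : realType) (r x : R) : 1 <= r ->
  gegenbauer_seq r x (fun n => (gegenbauer_poly r n).[x]).
Proof.
move=> r1; split=> [||n]; [by rewrite hornerE | by rewrite hornerX |].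
have k0 : n.+1%:R + r != 0 by rewrite gt_eqF //; have := ler0n R n.+1; lra.
rewrite gegenbauer_polySS hornerD hornerZ hornerD hornerN hornerM hornerX.
by rewrite addrAC subrr add0r mulrA [_ * (_ / _)]mulrC divfK.
Qed.

Lemma jacobi_orthogonal_low (R : realType) (a : R) (P : nat -> {poly R})
    (n : nat) (q : {poly R}) :
  0 <= a -> is_jacobi a a P -> (size q <= n)%N -> jacobi_dot a a (P n) q = 0.
Proof.
move=> a0 [sP oP _]; rewrite jacobi_dotC.
suff H k : (k <= n)%N -> forall q : {poly R}, (size q <= k)%N -> jacobi_dot a a q (P n) = 0.
  exact: (H n).
elim: k => [|k IH] kn {}q sq.
  move: sq; rewrite leqn0 size_poly_eq0 => /eqP ->.
  by rewrite -(scale0r (0 : {poly R})) jacobi_dotZl // mul0r.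
have lP : lead_coef (P k) != 0 by rewrite lead_coef_eq0 -size_poly_eq0 sP.
pose c := q`_k / lead_coef (P k).
rewrite -(subrK (c *: P k) q) jacobi_dotDl // jacobi_dotZl // oP; last first.
  by move=> kE; move: kn; rewrite kE ltnn.
rewrite mulr0 addr0 IH //; first exact: ltnW.
apply/leq_sizeP => m; rewrite leq_eqVlt => /predU1P[<-|km]; rewrite coefB coefZ.
  by rewrite /c lead_coefE sP /= divfK ?subrr // -[k in _`_k]/(k.+1.-1) -(sP k) -lead_coefE.
by rewrite !nth_default ?mulr0 ?subr0 ?sP // (leq_trans sq).
Qed.

(** The defect q = L (P n) + n (n + r) P n has lower degree, hence is orthogonal
to P n; by symmetry of L it is orthogonal to L (P n) as well, so to itself. *)
Lemma jacobi_eigen (R : realType) (a : R) (P : nat -> {poly R}) (n : nat) :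
  0 <= a -> is_jacobi a a P ->
  gegenbauer_op (2 * a + 1) (P n) = - (n%:R * (n%:R + (2 * a + 1))) *: P n.
Proof.
move=> a0 hP; have [sP _ _] := hP; set l := n%:R * _; set L := gegenbauer_op _.
pose q := l *: P n + L (P n).
have sq : (size q <= n)%N.
  apply/leq_sizeP => m nm; rewrite coefD coefZ coef_gegenbauer_op.
  rewrite (nth_default 0 (_ : size (P n) <= m.+2)%N); last by rewrite sP leqW.
  rewrite mulr0 sub0r; move: nm; rewrite leq_eqVlt => /predU1P[<-|nm].
    by rewrite -mulNr -mulrDl subrr mul0r.
  by rewrite nth_default ?sP // !mulr0 oppr0 addr0.
suff /eqP : q = 0 by rewrite /q addrC addr_eq0 scaleNr => /eqP.
apply/eqP/negPn/negP => q0; have := jacobi_dot_gt0 a0 q0.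
rewrite {1}/q jacobi_dotDl // jacobi_dotZl // gegenbauer_op_sym //.
rewrite !(jacobi_orthogonal_low a0 hP) ?mulr0 ?addr0 ?ltxx //.
exact: leq_trans (size_gegenbauer_op _ _) sq.
Qed.

(** The combination z of both polynomials that cancels the leading terms is
annihilated by L + n (n + r) but has degree less than n, so it is 0.  Evaluation
at 1 removes the factor of proportionality. *)
Lemma jacobi_gegenbauer (R : realType) (a x : R) (P : nat -> {poly R}) (n : nat) :
  0 <= a -> is_jacobi a a P ->
  normalized_at P n x = (gegenbauer_poly (2 * a + 1) n).[x].
Proof.
move=> a0 hP; set r := 2 * a + 1; have r1 : 1 <= r by rewrite /r; lra.
set G := gegenbauer_poly r n.
have G0 : G != 0.
  by apply/eqP => e; have := gegenbauer_poly1 r n; rewrite -/G e horner0 => /eqP; rewrite eq_sym oner_eq0.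
have [sP _ _] := hP.
have eG := gegenbauer_poly_eigen n r1; have eP := jacobi_eigen n a0 hP.
have sG := size_eigenpoly r1 G0 eG.
have P0 : P n != 0 by rewrite -size_poly_eq0 sP.
pose z := (- lead_coef (P n)) *: G + lead_coef G *: P n.
have z0 : z = 0.
  apply/eqP/negPn/negP => zn0.
  have eZ : gegenbauer_op r z = - (n%:R * (n%:R + r)) *: z.
    rewrite /z -[lead_coef G *: P n]addr0 !gegenbauer_op_linear eG eP.
    have -> : gegenbauer_op r 0 = 0 by rewrite /gegenbauer_op !deriv0 !mulr0 scaler0 subr0.
    rewrite !addr0 scalerDr !scalerA.
    by congr (_ *: _ + _ *: _); rewrite mulrC.
  have := size_eigenpoly r1 zn0 eZ; apply/eqP; rewrite ltn_eqF // ltnS.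
  apply/leq_sizeP => m; rewrite leq_eqVlt coefD !coefZ => /predU1P[<-|nm].
    by rewrite !lead_coefE sP sG /= mulNr mulrC addNr.
  by rewrite !nth_default ?mulr0 ?addr0 ?sP ?sG.
have eval y : lead_coef G * (P n).[y] = lead_coef (P n) * G.[y].
  have := congr1 (fun p : {poly R} => p.[y]) z0.
  by rewrite /z hornerD !hornerZ horner0 mulNr => /eqP; rewrite addrC subr_eq0 => /eqP.
have lG : lead_coef G != 0 by rewrite lead_coef_eq0.
have lP : lead_coef (P n) != 0 by rewrite lead_coef_eq0.
have e1 := eval 1; rewrite /G gegenbauer_poly1 mulr1 -/G in e1.
rewrite /normalized_at -(mulKf lG (P n).[x]) -(mulKf lG (P n).[1]) eval e1.
by field; rewrite lG lP.
Qed.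

(** * Monotonicity up to the least minimiser *)

Theorem corollary6p1 (R : realType) (alpha x : R) (P : nat -> {poly R})
    (U : nat -> R -> R) (k : nat)
    (halpha : 0 <= alpha)
    (hx : -1 < x < 1)
    (hP : is_jacobi alpha alpha P)
    (hU : forall n y, U n y = normalized_at P n y)
    (hk : least_argmin (fun n => U n x) k) :
  forall i : nat, (i < k)%N -> U i.+1 x <= U i x.
Proof.
pose u n := (gegenbauer_poly (2 * alpha + 1) n).[x].
have r1 : 1 <= 2 * alpha + 1 by lra.
have uE n : U n x = u n by rewrite hU (jacobi_gegenbauer _ _ halpha hP).
have hu : gegenbauer_seq (2 * alpha + 1) x u by exact: gegenbauer_poly_seq.
have [_ least] := hk.
move=> i; elim/ltn_ind: i => i IH ik; rewrite !uE leNgt; apply/negP => up.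
have mono n : (n < i)%N -> u n.+1 <= u n.
  by move=> ni; rewrite -!uE; apply: IH ni (ltn_trans ni ik).
have := least i; rewrite leqNgt ik => H; suff : false by []; apply: H => n.
rewrite !uE; exact: (first_descent_end_is_min r1 hx hu mono up).
Qed.
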